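(* Let $R$ be an integral domain of characteristic zero with fraction field $L$, let $x=(x_1,\dots,x_m)$, $H\in R[x]^m$ with $\mathcal{J}H$ symmetric, $h\in R[x]$ with $H=\nabla h$, and $r:=\operatorname{rk}\mathcal{J}H$. Let $t,u,v$ be new indeterminates and $y=(y_1,\dots,y_m)$. (i) If $r=0$, then there is an image apex $b\in R^m$ of $H$ over $L$, and $h=g+b_1x_1+\cdots+b_mx_m$ with $g\in R$. Moreover $\{b\}$ is both the Zariski closure of the image of $H:L^m\to L^m$ and the set of image apices of $H$ over $L$, and for every $f\in L[y]$: $f(H)=0\iff f((1-t)H+tb)=0\iff f(b)=0$. (ii) If $r\le1$ and $R$ is a gcd-domain, then there is an image apex $b\in R^m$ of $H$ over $L$ and $h=g(p_1x_1+\cdots+p_mx_m)+b_1x_1+\cdots+b_mx_m$ with $g\in R[t]$, $p\in R^m$, $\operatorname{rk}(p)=r$. Moreover $\{b+\lambda p:\lambda\in L\}$ is both the Zariski closure of the image of $H$ and the set of image apices of $H$ over $L$, and for every $f\in L[y]$: $f(H)=0\iff f(tp+(1-u)H+ub)=0\iff f(tp+b)=0$. (iii) Suppose $b\in R^m$ is an image apex of $H$ over $L$. If $r\le2$ and $R$ is a Bézout domain, then $h=g(p_1x_1+\cdots+p_mx_m,\,q_1x_1+\cdots+q_mx_m)+b_1x_1+\cdots+b_mx_m$ with $g\in R[t,u]$, $p,q\in R^m$ and $\operatorname{rk}(p|q)=r$. Moreover $\{b+\lambda p+\mu q:\lambda,\mu\in L\}$ is both the Zariski closure of the image of $H$ and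 the set of image apices of $H$ over $L$, and for every $f\in L[y]$: $f(H)=0\iff f(tp+uq+(1-v)H+vb)=0\iff f(tp+uq+b)=0$.
   Context: $\mathcal{J}H$ is the Jacobian matrix of $H$ with respect to $x$, rank over $L(x)$; $\nabla h=(\partial h/\partial x_1,\dots,\partial h/\partial x_m)$. For $H\in L[x]^m$, $a\in L^m$ is an image apex of $H$ over $L$ if for every $f\in L[y]$, $f(H)=0$ implies $f((1-t)H+ta)=0$; $p\in L^m$ is a projective image apex of $H$ over $L$ if $p\ne0$ and $f(H)=0$ implies $f(H+tp)=0$ for every $f\in L[y]$. A gcd-domain: any two elements have a gcd; a Bézout domain: every finitely generated ideal is principal. *)

(* Defs.v *)
From HB Require Import structures.
From mathcomp Require Import all_boot all_order all_algebra.
From mathcomp Require Import fraction.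
From mathcomp Require Import mpoly.

Set Implicit Arguments.
Unset Strict Implicit.
Unset Printing Implicit Defensive.

Import GRing.Theory.
Local Open Scope ring_scope.

Definition mcomp (R : nzRingType) (m k : nat) (F : 'I_m -> {mpoly R[k]})
  (f : {mpoly R[m]}) : {mpoly R[k]} := f \mPo [tuple F i | i < m].

(* In R[x_1..x_m, e_1..e_k]: the variable x_i, and the new variable e_j. *)
Definition xvar (R : nzRingType) (m k : nat) (i : 'I_m) : {mpoly R[m + k]} :=
  'X_(lshift k i).
Definition evar (R : nzRingType) (m k : nat) (j : 'I_k) : {mpoly R[m + k]} :=
  'X_(rshift m j).

Definition lift_x (R : nzRingType) (m k : nat) (p : {mpoly R[m]}) : {mpoly R[m + k]} :=
  mcomp (fun i => @xvar R m k i) p.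

Definition cstv (R : nzRingType) (m k : nat) (a : 'I_m -> R) (i : 'I_m) : {mpoly R[k]} :=
  (a i)%:MP.

Definition image_apex (L : fieldType) (m : nat) (H : 'I_m -> {mpoly L[m]})
  (a : 'I_m -> L) : Prop :=
  forall f : {mpoly L[m]}, mcomp H f = 0 ->
    mcomp (fun i => (1 - @evar L m 1 ord0) * lift_x 1 (H i)
                    + @evar L m 1 ord0 * (a i)%:MP) f = 0.

Definition in_zariski_closure_image (L : fieldType) (m : nat)
  (H : 'I_m -> {mpoly L[m]}) (z : 'I_m -> L) : Prop :=
  forall f : {mpoly L[m]},
    (forall c : 'I_m -> L, f.@[fun i => (H i).@[c]] = 0) -> f.@[z] = 0.

Definition jacobian (R : nzRingType) (m : nat) (H : 'I_m -> {mpoly R[m]}) :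
  'M[{mpoly R[m]}]_m := \matrix_(i, j) mderiv j (H i).

Definition toL (R : idomainType) (x : R) : {fraction R} := tofrac x.
Definition polyL (R : idomainType) (m : nat) (p : {mpoly R[m]}) :
  {mpoly {fraction R}[m]} := map_mpoly (@toL R) p.

Definition jac_rank (R : idomainType) (m : nat) (H : 'I_m -> {mpoly R[m]}) : nat :=
  \rank (map_mx (fun p => tofrac (polyL p)) (jacobian H)).

Definition rank1 (R : idomainType) (m : nat) (p : 'I_m -> R) : nat :=
  \rank (\matrix_(i < m, j < 1) toL (p i)).
Definition rank2 (R : idomainType) (m : nat) (p q : 'I_m -> R) : nat :=
  \rank (\matrix_(i < m, j < 2) toL (if j == ord0 then p i else q i)).

Definition linform (R : nzRingType) (m : nat) (c : 'I_m -> R) : {mpoly R[m]} :=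
  \sum_(i < m) c i *: 'X_i.

Definition dvd (R : comRingType) (a b : R) : Prop := exists c, b = c * a.

Definition gcd_domain (R : idomainType) : Prop :=
  forall a b : R, exists d : R,
    [/\ dvd d a, dvd d b & forall c, dvd c a -> dvd c b -> dvd c d].

Definition bezout_domain (R : idomainType) : Prop :=
  forall (n : nat) (a : 'I_n -> R), exists d : R,
    forall x : R, (exists c : 'I_n -> R, x = \sum_(i < n) c i * a i) <-> dvd d x.

Definition polyLv (R : idomainType) (m : nat) (H : 'I_m -> {mpoly R[m]})
  (i : 'I_m) : {mpoly {fraction R}[m]} := polyL (H i).
Definition vecL (R : idomainType) (m : nat) (b : 'I_m -> R) (i : 'I_m) :
  {fraction R} := toL (b i).

(* Main.v *)
Require Import Defs.
From Stdlib Require Import Classical.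
From HB Require Import structures.
From mathcomp Require Import all_boot all_order all_algebra.
From mathcomp Require Import fraction.
From mathcomp Require Import mpoly.
From mathcomp Require Import ring zify.

(** Let A be the Hessian of h. If P, Q are vector fields in ker A, then so is the derivative of P
    along Q; hence, for generic c, the map H is constant on the affine space c + ker A(c).
    - If rk A <= 1, two such fibres with distinct directions are meeting hyperplanes, which would
      make H constant; so the kernel of A is constant.
    - If rk A = 2 and 0 is an image apex, any three of the components of H are algebraically
      dependent (H factors generically through a plane), so the apex property puts H in the row
      space of A: e A = H for some rational vector field e. The kernel of A is parallel along itself
      and along e. Since x + t P(x) preserves H for a suitably normalised kernel field P, the
      derivative of P is nilpotent modulo the kernel, which makes the kernel parallel along the
      vectors orthogonal to H as well. If e.H != 0 these directions span everything and the kernel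
      is constant; if e.H = 0 the level sets of h are parallel hyperplanes and rk A <= 1.
    A constant kernel means that the row space T of A is constant. Relations among the components
    of H are then stable under translation by T, so the closure of the image is b + T, and
    h - b.x is a polynomial in linear forms spanning T. These forms, and the polynomial, are made
    integral by a Gauss-type argument on gcds of powers, respectively by a dual basis. *)

Set Implicit Arguments.
Unset Strict Implicit.
Unset Printing Implicit Defensive.

Import GRing.Theory.
Local Open Scope ring_scope.

(** * Derivations, composition and restriction of polynomials to lines *)

Lemma mpoly_ring_ind (R : nzRingType) (n : nat) (Q : {mpoly R[n]} -> Prop) :
  (forall c, Q c%:MP) -> (forall i, Q 'X_i) ->
  (forall p q, Q p -> Q q -> Q (p + q)) -> (forall p q, Q p -> Q q -> Q (p * q)) ->
  forall p, Q p.
Proof.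
move=> QC QX QD QM; elim/mpolyind => [|c u p _ _ Qp]; first by rewrite -(mpolyC0 n R).
apply/QD => //; rewrite -mul_mpolyC; apply/QM => //; rewrite mpolyXE_id.
apply: (big_ind Q) => [||i _]; [by rewrite -(mpolyC1 n R) | exact: QM |].
elim: (u i) => [|k IHk]; first by rewrite expr0 -(mpolyC1 n R).
by rewrite exprS; apply/QM.
Qed.

(** Chain rule for an abstract derivation [d] that kills the coefficients. It serves both for
    partial derivatives of a composition and for the derivative of a polynomial along a line. *)
Lemma mmap_derivation (R : nzRingType) (S : comNzRingType) (n : nat)
    (f : {rmorphism R -> S}) (h : 'I_n -> S) (d : S -> S) :
  {morph d : x y / x + y} -> (forall x y, d (x * y) = d x * y + x * d y) ->
  (forall c, d (f c) = 0) ->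
  forall p, d (mmap f h p) = \sum_i mmap f h p^`M(i) * d (h i).
Proof.
move=> dD dM df; elim/mpoly_ring_ind => [c|i|p q IHp IHq|p q IHp IHq].
- by rewrite mmapC df big1 // => i _; rewrite mderivC mmap0 mul0r.
- rewrite mmapX mmap1U (bigD1 i) //= [X in _ + X]big1 => [|j ne_ji].
    by rewrite mderivX mnm1E eqxx scale1r -{1}[U_(i)%MM]add0m addmK mpolyX0 rmorph1 mul1r addr0.
  by rewrite mderivX mnm1E eq_sym (negPf ne_ji) scale0r mmap0 mul0r.
- rewrite mmapD dD IHp IHq -big_split; apply: eq_bigr => i _ /=.
  by rewrite mderivD mmapD mulrDl.
- rewrite rmorphM dM IHp IHq mulr_suml mulr_sumr -big_split.
  apply: eq_bigr => i _ /=; rewrite mderivM mmapD !rmorphM /=; ring.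
Qed.

Lemma mderiv_mcomp (R : comNzRingType) (m k : nat) (F : 'I_m -> {mpoly R[k]})
    (f : {mpoly R[m]}) (j : 'I_k) :
  (mcomp F f)^`M(j) = \sum_i mcomp F f^`M(i) * (F i)^`M(j).
Proof.
rewrite /mcomp /comp_mpoly (@mmap_derivation _ _ _ _ _ (mderiv j)).
- by apply: eq_bigr => i _; rewrite tnth_mktuple.
- exact: mderivD.
- exact: mderivM.
- by move=> c; rewrite mderivC.
Qed.

Lemma meval_mcomp (R : comNzRingType) (m k : nat) (F : 'I_m -> {mpoly R[k]})
    (f : {mpoly R[m]}) (v : 'I_k -> R) :
  (mcomp F f).@[v] = f.@[fun i => (F i).@[v]].
Proof.
rewrite comp_mpoly_meval; apply: meval_eq => i.
by rewrite tnth_mktuple.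
Qed.

Definition ddir (R : nzRingType) (m : nat) (P : 'rV[{mpoly R[m]}]_m)
  (p : {mpoly R[m]}) : {mpoly R[m]} := \sum_i P 0 i * p^`M(i).

Definition mxC (R : nzRingType) (k m n : nat) (M : 'M[R]_(m, n)) :
  'M[{mpoly R[k]}]_(m, n) := map_mx (@mpolyC k R) M.

(** The restriction of [p] to the affine line through [c] with direction [w], as a polynomial in the
    line parameter. *)
Definition mline (R : comNzRingType) (m : nat) (c w : 'rV[R]_m)
  (p : {mpoly R[m]}) : {poly R} :=
  mmap polyC (fun i => (c 0 i)%:P + 'X * (w 0 i)%:P) p.

Lemma horner_mline (R : comNzRingType) (m : nat) (c w : 'rV[R]_m) p t :
  (mline c w p).[t] = p.@[(c + t *: w) 0].
Proof.
elim/mpoly_ring_ind: p => [a|i|p q IHp IHq|p q IHp IHq].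
- by rewrite /mline mmapC hornerC mevalC.
- by rewrite /mline mmapX mmap1U !hornerE mevalXU !mxE.
- by rewrite /mline mmapD hornerD mevalD -IHp -IHq.
- by rewrite /mline rmorphM hornerM mevalM -IHp -IHq.
Qed.

Lemma deriv_mline (R : comNzRingType) (m : nat) (c w : 'rV[R]_m) p :
  (mline c w p)^`() = mline c w (ddir (mxC m w) p).
Proof.
rewrite /mline (@mmap_derivation _ _ _ _ _ (@deriv R)).
- rewrite /ddir raddf_sum; apply: eq_bigr => i _ /=.
  rewrite derivD derivC add0r derivM derivX derivC mulr0 addr0 mul1r.
  by rewrite rmorphM /= mxE mmapC mulrC.
- exact: derivD.
- exact: derivM.
- exact: derivC.
Qed.

(** * Polynomials and polynomial functions in characteristic zero *)

Section PolynomialFunctions.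

Variables (L : idomainType) (char0 : [pchar L] =i pred0).

Lemma natf_neq0_char0 n : n.+1%:R != 0 :> L.
Proof. by rewrite natf_neq0_pchar; apply/allP => p; rewrite /= inE /= char0. Qed.

(** The numerals are pairwise distinct in characteristic zero, so [p] has [size p] distinct roots,
    one more than a nonzero polynomial can have. *)
Lemma poly_eq0_char0 (p : {poly L}) : (forall t, p.[t] = 0) -> p = 0.
Proof.
move=> p0; apply/eqP; apply: contraT => nz_p.
pose s := [seq n%:R : L | n <- iota 0 (size p)].
have inj : {in iota 0 (size p) &, injective (fun n => n%:R : L)}.
  move=> a b _ _; wlog le_ab : a b / (a <= b)%N => [IH|] /=.
    by case/orP: (leq_total a b) => /IH // /(_ _)/esym E /esym /E.
  move/eqP; rewrite eq_sym -subr_eq0 -natrB //.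
  by case E: (b - a)%N => [|k]; [lia | rewrite (negPf (natf_neq0_char0 k))].
have := @max_poly_roots _ p s nz_p.
rewrite map_inj_in_uniq // iota_uniq size_map size_iota ltnn; apply => //.
by apply/allP => t _; apply/rootP.
Qed.

Lemma mderiv_all0 (n : nat) (p : {mpoly L[n]}) :
  (forall i, p^`M(i) = 0) -> p = (p@_0%MM)%:MP.
Proof.
move=> p'0; apply/mpolyP => u; rewrite mcoeffC.
case: eqVneq => [->|nz_u]; first by rewrite mulr1.
have [i ui] : exists i, u i != 0%N.
  apply/existsP; apply: contraNT nz_u; rewrite negb_exists => /forallP u0.
  by apply/eqP/mnmP => i; rewrite mnm0E; apply/eqP; rewrite -[_ == _]negbK u0.
have /(congr1 (mcoeff (u - U_(i)))) := p'0 i.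
rewrite mcoeff_mderiv mcoeff0 submK ?lep1mP // mulr0 => /eqP.
by rewrite -mulr_natr mulf_eq0 (negPf (natf_neq0_char0 _)) orbF => /eqP.
Qed.

Lemma ddir_delta (n : nat) (i : 'I_n) (p : {mpoly L[n]}) :
  ddir (mxC n (delta_mx 0 i)) p = p^`M(i).
Proof.
rewrite /ddir (bigD1 i) //= big1 => [|j ne_ji].
  by rewrite !mxE !eqxx mpolyC1 mul1r addr0.
by rewrite !mxE (negPf ne_ji) mpolyC0 mul0r.
Qed.

(** Induction on a degree bound: the partial derivatives of [p] vanish by induction, so [p] is a
    constant, and this constant is its value at [v]. *)
Lemma mderiv_closed_eq0 (n : nat) (Q : {mpoly L[n]} -> Prop) (v : 'I_n -> L) :
  (forall p i, Q p -> Q p^`M(i)) -> (forall p, Q p -> p.@[v] = 0) ->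
  forall p, Q p -> p = 0.
Proof.
move=> Qd Qv p; have [k] : exists k, forall u, (k <= mdeg u)%N -> p@_u = 0.
  by exists (msize p) => u /msize_mdeg_ge; rewrite mcoeff_msupp negbK => /eqP.
elim: k p => [|k IH] p pk Qp; first by apply/mpolyP => u; rewrite pk // mcoeff0.
have p'0 i : p^`M(i) = 0.
  apply: IH (Qd _ i Qp) => u le_ku.
  by rewrite mcoeff_mderiv pk ?mul0rn // mdegD mdeg1; lia.
rewrite (mderiv_all0 p'0); have := Qv _ Qp.
by rewrite {1}(mderiv_all0 p'0) mevalC => ->; rewrite mpolyC0.
Qed.

(** Vanishing at all points is inherited by partial derivatives, because the restriction to a line
    parallel to a coordinate axis is the zero polynomial. Hence [mderiv_closed_eq0] applies. *)
Lemma meval_all0 (n : nat) (p : {mpoly L[n]}) :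
  (forall c : 'rV[L]_n, p.@[c 0] = 0) -> p = 0.
Proof.
move: p; apply: (@mderiv_closed_eq0 _ _ ((0 : 'rV[L]_n) 0)) => [p i p0 c|p]; last exact.
have : mline c (delta_mx 0 i) p = 0.
  by apply: poly_eq0_char0 => t; rewrite horner_mline p0.
move/(congr1 (fun q => q^`().[0])); rewrite deriv_mline deriv0 horner0.
by rewrite horner_mline scale0r addr0 ddir_delta.
Qed.

Lemma derivn_all0 (p : {poly L}) : (forall k, p^`(k.+1).[0] = 0) -> p = (p`_0)%:P.
Proof.
move=> p0; apply/polyP => [[|k]]; rewrite coefC //=.
have := p0 k; rewrite horner_coef0 coef_derivn addn0 ffactnn => /eqP.
rewrite -mulr_natr mulf_eq0 -(prednK (fact_gt0 _)).
by rewrite (negPf (natf_neq0_char0 _)) orbF => /eqP.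
Qed.

End PolynomialFunctions.

(** * Derivatives along polynomial vector fields *)

Definition evmx (R : nzRingType) (k m n : nat) (c : 'rV[R]_k)
  (M : 'M[{mpoly R[k]}]_(m, n)) : 'M[R]_(m, n) := map_mx (meval (c 0)) M.

Definition ddirv (R : nzRingType) (m n : nat) (Q : 'rV[{mpoly R[m]}]_m)
  (P : 'rV[{mpoly R[m]}]_n) : 'rV[{mpoly R[m]}]_n := map_mx (ddir Q) P.

(* The sum of all [P_(i_1) ... P_(i_k) * d^k p / dx_(i_1) ... dx_(i_k)]; the [P_i] are not
   differentiated. *)
Fixpoint tdir (R : nzRingType) (m : nat) (P : 'rV[{mpoly R[m]}]_m) k p :=
  if k is k'.+1 then \sum_i P 0 i * tdir P k' p^`M(i) else p.

Section Directions.

Variables (R : comNzRingType) (m : nat).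
Implicit Types (P Q : 'rV[{mpoly R[m]}]_m) (p q : {mpoly R[m]}).

Lemma ddir_is_additive P : {morph ddir P : p q / p + q}.
Proof.
move=> p q; rewrite /ddir -big_split; apply: eq_bigr => i _.
by rewrite mderivD mulrDr.
Qed.

Lemma ddir0 P : ddir P 0 = 0.
Proof. by rewrite /ddir big1 // => i _; rewrite mderiv0 mulr0. Qed.

Lemma ddirM P p q : ddir P (p * q) = ddir P p * q + p * ddir P q.
Proof.
rewrite /ddir mulr_suml mulr_sumr -big_split; apply: eq_bigr => i _ /=.
by rewrite mderivM; ring.
Qed.

Lemma ddirC P a : ddir P a%:MP = 0.
Proof. by rewrite /ddir big1 // => i _; rewrite mderivC mulr0. Qed.

Lemma ddir_sum P I (r : seq I) (F : I -> {mpoly R[m]}) :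
  ddir P (\sum_(i <- r) F i) = \sum_(i <- r) ddir P (F i).
Proof. exact: (big_morph _ (ddir_is_additive P) (ddir0 P)). Qed.

Lemma ddirDl P Q p : ddir (P + Q) p = ddir P p + ddir Q p.
Proof.
by rewrite /ddir -big_split; apply: eq_bigr => i _; rewrite mxE mulrDl.
Qed.

Lemma ddirZl a P p : ddir (a *: P) p = a * ddir P p.
Proof.
by rewrite /ddir mulr_sumr; apply: eq_bigr => i _; rewrite mxE mulrA.
Qed.

Lemma tdirS P k p : tdir P k.+1 p = \sum_i P 0 i * tdir P k p^`M(i).
Proof. by []. Qed.

(* The hypothesis says that [P / d] is constant along itself; its [k]-th iterate, applied to [p],
   is then [tdir P k p / d^k]. *)
Lemma ddir_tdir P (d : {mpoly R[m]}) :
  (forall i, d * ddir P (P 0 i) = ddir P d * P 0 i) ->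
  forall k p, d * ddir P (tdir P k p)
              = d * tdir P k.+1 p + (ddir P d * tdir P k p) *+ k.
Proof.
move=> dP; elim=> [|k IHk] p; first by rewrite mulr0n addr0.
rewrite (tdirS _ k p) (tdirS _ k.+1 p) ddir_sum !mulr_sumr.
rewrite -sumrMnl -big_split; apply: eq_bigr => i _.
rewrite ddirM mulrDr [d * (ddir _ _ * _)]mulrA dP [d * (_ * ddir _ _)]mulrCA IHk.
rewrite mulrS mulrDr mulrnAr -mulrA [_ * (d * _)]mulrCA.
by rewrite [P 0 i * (ddir P d * _)]mulrCA addrCA.
Qed.

(** If [tdir P k.+1 p] vanishes, both it and its derivative along [P] drop out of [ddir_tdir], which
    leaves [d] times the next term equal to zero. *)
Lemma tdir_eq0 P (d : {mpoly R[m]}) p : (forall q, d * q = 0 -> q = 0) ->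
  (forall i, d * ddir P (P 0 i) = ddir P d * P 0 i) -> ddir P p = 0 ->
  forall k, tdir P k.+1 p = 0.
Proof.
move=> d0 dP Pp; elim=> [|k IHk]; first exact: Pp.
apply: d0; have := ddir_tdir dP k.+1 p.
by rewrite IHk ddir0 !mulr0 mul0rn addr0 => <-.
Qed.

(** Since [tdir] never differentiates the coefficients of [P], at [c] they may be frozen to the
    constant direction [P(c)]. *)
Lemma horner_derivn_mline (c : 'rV[R]_m) P k p :
  ((mline c (evmx c P) p)^`(k)).[0] = (tdir P k p).@[c 0].
Proof.
elim: k p => [|k IHk] p; first by rewrite derivn0 horner_mline scale0r addr0.
rewrite derivSn deriv_mline tdirS rmorph_sum.
have -> : mline c (evmx c P) (ddir (mxC m (evmx c P)) p) =
   \sum_i (P 0 i).@[c 0]%:P * mline c (evmx c P) p^`M(i).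
  rewrite /mline raddf_sum; apply: eq_bigr => i _ /=.
  by rewrite rmorphM /= !mxE mmapC.
rewrite linear_sum horner_sum; apply: eq_bigr => i _.
by rewrite rmorphM /= -IHk mul_polyC linearZ hornerZ.
Qed.

End Directions.

Lemma mline_const (L : fieldType) (char0 : [pchar L] =i pred0) (m : nat)
  (c : 'rV[L]_m) (P : 'rV[{mpoly L[m]}]_m) p :
  (forall k, (tdir P k.+1 p).@[c 0] = 0) ->
  forall t, p.@[(c + t *: evmx c P) 0] = p.@[c 0].
Proof.
move=> Pp t; rewrite -horner_mline (derivn_all0 char0 (p := mline _ _ _)).
  by rewrite hornerC -horner_coef0 horner_mline scale0r addr0.
by move=> k; rewrite horner_derivn_mline.
Qed.

(** * Generic rank and projections onto kernels of polynomial matrices *)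

Lemma scalemx_eq0 (R : idomainType) (m n : nat) (d : R) (M : 'M[R]_(m, n)) :
  d != 0 -> d *: M = 0 -> M = 0.
Proof.
move=> nz_d /matrixP dM; apply/matrixP => i j; have /eqP := dM i j.
by rewrite !mxE mulf_eq0 (negPf nz_d) => /eqP.
Qed.

Lemma fraction_numden (R : idomainType) (x : {fraction R}) :
  exists2 b : R, b != 0 & exists a : R, tofrac a = tofrac b * x.
Proof.
elim/quotW: x => x; exists (frac x).2; first exact: denom_ratioP.
exists (frac x).1; unlock FracField.tofrac; rewrite -[RHS]FracField.pi_mul.
apply/eqmodP; rewrite /= FracField.equivfE /FracField.mulf.
by rewrite !numden_Ratio ?(oner_neq0, mulr1, mul1r) ?denom_ratioP // mulrC.
Qed.

Lemma fractions_common_den (R : idomainType) (I : finType) (F : I -> {fraction R}) :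
  exists2 b : R, b != 0 & exists a : I -> R, forall i, tofrac (a i) = tofrac b * F i.
Proof.
suff [b nz_b bP] : exists2 b : R, b != 0 &
    forall i, i \in enum I -> exists a : R, tofrac a = tofrac b * F i.
  by exists b => //; apply: (fin_all_exists (fun i => bP i (mem_enum _ _))).
elim: (enum I) => [|i s [b nz_b IHb]]; first by exists 1; rewrite ?oner_neq0.
have [d nz_d [a Ea]] := fraction_numden (F i).
exists (b * d) => [|j]; first by rewrite mulf_neq0.
rewrite inE => /orP[/eqP->|/IHb[a' Ea']].
  by exists (b * a); rewrite !rmorphM /= Ea mulrA.
by exists (a' * d); rewrite !rmorphM /= Ea' mulrAC.
Qed.

Notation fracmx := (map_mx (@FracField.tofrac _)).

Lemma clear_denominators (R : idomainType) (m n : nat) (M : 'M[{fraction R}]_(m, n)) :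
  exists2 b : R, b != 0 & exists M' : 'M[R]_(m, n), fracmx M' = tofrac b *: M.
Proof.
have [b nz_b [a aP]] := fractions_common_den (fun ij => M ij.1 ij.2).
exists b => //; exists (\matrix_(i, j) a (i, j)).
by apply/matrixP => i j; rewrite !mxE aP.
Qed.

Lemma map_tofrac_inj (R : idomainType) (m n : nat) (M N : 'M[R]_(m, n)) :
  fracmx M = fracmx N -> M = N.
Proof.
move=> MN; apply/matrixP => i j; apply/eqP; rewrite -tofrac_eq; apply/eqP.
by move/matrixP/(_ i j): MN; rewrite !mxE.
Qed.

Notation rankF M := (\rank (fracmx M)).

Lemma tofrac_mxC (L : fieldType) (k m n : nat) (D : 'M[L]_(m, n)) :
  fracmx (mxC k D) = map_mx (@FracField.tofrac _ \o @mpolyC k L) D.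
Proof. by rewrite /mxC -map_mx_comp. Qed.

(** [D] is a constant 0-1 matrix that selects a maximal independent set of rows of [A]. The product
    [D A] then has a right inverse [X / d] over the fraction field, and every row of [A] is a
    combination of the selected ones. *)
Lemma kernel_frame (L : fieldType) (k m n : nat) (A : 'M[{mpoly L[k]}]_(m, n)) :
  exists (D : 'M[L]_(rankF A, m)) (X : 'M[{mpoly L[k]}]_(n, rankF A)) (d : {mpoly L[k]}),
    [/\ d != 0, D *m D^T = 1%:M, mxC k D *m A *m X = d%:M
      & A *m X *m mxC k D *m A = d *: A].
Proof.
set AK := fracmx A; pose f := maxrankfun AK.
pose D : 'M[L]_(\rank AK, m) := rowsub f 1%:M.
have DK : fracmx (mxC k D *m A) = rowsub f AK.
  rewrite map_mxM tofrac_mxC rowsubE; congr (_ *m _).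
  by apply/matrixP => i j; rewrite !mxE /= !rmorph_nat.
have free_DA : row_free (fracmx (mxC k D *m A)) by rewrite DK maxrowsub_free.
have [d nz_d [X XP]] := clear_denominators (pinvmx (fracmx (mxC k D *m A))).
exists D, X, d; split => //.
- apply/matrixP => i j; rewrite !mxE (bigD1 (f i)) //= big1 => [|l /negPf ne].
    rewrite !mxE eqxx mul1r addr0; congr (_%:R); congr nat_of_bool.
    by rewrite eq_sym (inj_eq (@maxrankfun_inj _ _ _ _)).
  by rewrite !mxE eq_sym ne mul0r.
- apply: map_tofrac_inj; rewrite map_mxM XP -scalemxAr mulmxVp // map_scalar_mx.
  by rewrite scalemx1.
- have AK_sub : (AK <= fracmx (mxC k D *m A))%MS.
    by rewrite DK eq_maxrowsub.
  apply: map_tofrac_inj; rewrite -mulmxA !map_mxM XP.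
  rewrite -map_mxM -scalemxAr -scalemxAl map_mxZ -/AK.
  by rewrite mulmxKpV.
Qed.

Lemma evmx_mxC (R : nzRingType) (k m n : nat) (c : 'rV[R]_k) (M : 'M[R]_(m, n)) :
  evmx c (mxC k M) = M.
Proof. by apply/matrixP => i j; rewrite !mxE mevalC. Qed.

Lemma evmxM (R : comNzRingType) (k m n p : nat) (c : 'rV[R]_k)
    (M : 'M[{mpoly R[k]}]_(m, n)) (N : 'M_(n, p)) :
  evmx c (M *m N) = evmx c M *m evmx c N.
Proof. exact: map_mxM. Qed.

Section KernelProjection.

Variables (L : fieldType) (k : nat).

(* [N / d] is the projection onto the left kernel of [A] along that of the constant matrix [S]. *)
Lemma kernel_projection (m n : nat) (A : 'M[{mpoly L[k]}]_(m, n)) :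
  exists (d : {mpoly L[k]}) (S : 'M[L]_m) (N : 'M[{mpoly L[k]}]_m)
      (B : 'M[{mpoly L[k]}]_(n, m)),
    [/\ d != 0, \rank S = (m - rankF A)%N, N + A *m B = d%:M, N *m A = 0
      & N *m mxC k S = d *: mxC k S /\ mxC k S *m N = N].
Proof.
have [D [X [d [nz_d DDT DAX AXDA]]]] := kernel_frame A.
(* [S] is the coordinate projection onto the indices that [D] does not select; [N] is
   [d - A X D]. *)
pose S := 1%:M - D^T *m D.
have CS : mxC k S = 1%:M - mxC k D^T *m mxC k D.
  by rewrite /mxC map_mxB map_mx1 map_mxM.
have CDDT : mxC k D *m mxC k D^T = 1%:M by rewrite -map_mxM DDT map_mx1.
exists d, S, (d%:M - A *m X *m mxC k D), (X *m mxC k D); split.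
- exact: nz_d.
- have DS : D *m S = 0 by rewrite mulmxBr mulmx1 mulmxA DDT mul1mx subrr.
  have rD : \rank D = rankF A.
    apply/eqP; rewrite eqn_leq rank_leq_row -{1}(mxrank1 L (rankF A)) -DDT.
    exact: mxrankM_maxl.
  have := mulmx0_rank_max DS; rewrite rD => le1.
  have : (m <= \rank S + \rank (D^T *m D))%N.
    by rewrite -{1}(mxrank1 L m) -[1%:M](subrK (D^T *m D)) mxrank_add.
  by have := mxrankM_maxr D^T D; rewrite rD; lia.
- by rewrite mulmxA subrK.
- by rewrite mulmxBl AXDA mul_scalar_mx subrr.
split.
- rewrite CS mulmxBl mul_scalar_mx mulmxBr mulmx1 -[_ *m mxC k D *m _]mulmxA.
  by rewrite [mxC k D *m _]mulmxA CDDT mul1mx subrr subr0.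
- rewrite CS mulmxBl mul1mx mulmxBr -!mulmxA [mxC k D *m (A *m _)]mulmxA.
  rewrite [mxC k D *m A *m _]mulmxA DAX mul_mx_scalar mul_scalar_mx -scalemxAr.
  by rewrite subrr subr0.
Qed.

Variables (m n : nat) (A : 'M[{mpoly L[k]}]_(m, n)) (d : {mpoly L[k]}) (S : 'M[L]_m)
  (N : 'M[{mpoly L[k]}]_m) (B : 'M[{mpoly L[k]}]_(n, m)).
Hypotheses (nz_d : d != 0) (rS : \rank S = (m - rankF A)%N)
  (NAB : N + A *m B = d%:M) (NA : N *m A = 0) (NS : N *m mxC k S = d *: mxC k S)
  (SN : mxC k S *m N = N).

(** For [P] in the left kernel of [A], multiplying out gives [d P = P N = P S N]. *)
Lemma kernel_meets_S (p : nat) (P : 'M_(p, m)) : P *m A = 0 -> P *m mxC k S = 0 -> P = 0.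
Proof.
move=> PA PS; have : P *m d%:M = 0.
  by rewrite -NAB mulmxDr mulmxA PA mul0mx addr0 -SN mulmxA PS mul0mx.
by rewrite mul_mx_scalar => /(scalemx_eq0 nz_d).
Qed.

Variables (c : 'rV[L]_k) (nz_dc : d.@[c 0] != 0).

Let evd (p : nat) (P : 'M[L]_(p, m)) : P *m evmx c N + P *m evmx c A *m evmx c B = d.@[c 0] *: P.
Proof.
rewrite -mulmxA -evmxM -mulmxDr -map_mxD NAB map_scalar_mx.
by rewrite mul_mx_scalar.
Qed.

(** Every kernel vector [w] at a point where [d] does not vanish is thus, up to the factor [d(c)],
    the value of the polynomial kernel field [w N]. *)
Lemma kernel_at (w : 'rV[L]_m) : w *m evmx c A = 0 -> w *m evmx c N = d.@[c 0] *: w.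
Proof. by move=> wA; rewrite -evd wA mul0mx addr0. Qed.

Lemma kernel_at_meets_S (w : 'rV[L]_m) : w *m evmx c A = 0 -> w *m S = 0 -> w = 0.
Proof.
move=> wA wS; have := kernel_at wA.
rewrite -SN evmxM evmx_mxC mulmxA wS mul0mx => /esym/eqP.
by rewrite scaler_eq0 (negPf nz_dc) => /eqP.
Qed.

(** [N(c) S = d(c) S] shows that [N(c)] has rank at least that of [S], and [N(c)] annihilates
    [A(c)]. *)
Lemma rank_at : (\rank (evmx c A) <= rankF A)%N.
Proof.
have le1 : (\rank (evmx c N) + \rank (evmx c A) <= m)%N.
  by apply: mulmx0_rank_max; rewrite -evmxM NA /evmx map_mx0.
have le2 : (\rank S <= \rank (evmx c N))%N.
  rewrite -(mxrank_scale_nz S nz_dc).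
  have -> : d.@[c 0] *: S = evmx c N *m S.
    by rewrite -{2}(evmx_mxC c S) -evmxM NS /evmx map_mxZ -/(evmx c _) evmx_mxC.
  exact: mxrankM_maxl.
by move: le1 le2 (rank_leq_row (fracmx A)); rewrite rS; lia.
Qed.

End KernelProjection.

(** * Hessians and totally geodesic kernels *)

Section Autoparallel.

Variables (R : comNzRingType) (m : nat).
Implicit Types (P Q : 'rV[{mpoly R[m]}]_m).

Lemma ddir_mulmx (p q : nat) (Q : 'rV[{mpoly R[m]}]_m) (P : 'rV[{mpoly R[m]}]_p)
    (A : 'M[{mpoly R[m]}]_(p, q)) j :
  ddir Q ((P *m A) 0 j) = (ddirv Q P *m A) 0 j + \sum_i P 0 i * ddir Q (A i j).
Proof.
rewrite !mxE ddir_sum -big_split; apply: eq_bigr => i _.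
by rewrite ddirM !mxE.
Qed.

Lemma ddirv_mulC (p q : nat) Q (P : 'rV[{mpoly R[m]}]_p) (M : 'M[R]_(p, q)) :
  ddirv Q (P *m mxC m M) = ddirv Q P *m mxC m M.
Proof.
apply/rowP => j; rewrite mxE ddir_mulmx [X in _ + X]big1 ?addr0 // => i _.
by rewrite mxE ddirC mulr0.
Qed.

Definition grad (p : {mpoly R[m]}) : 'rV[{mpoly R[m]}]_m := \row_i p^`M(i).

(** Rows are indexed by the variables, transposed with respect to [jacobian], so that [P *m jac G]
    collects the derivatives of [G] along [P]. *)
Definition jac (n : nat) (G : 'I_n -> {mpoly R[m]}) : 'M[{mpoly R[m]}]_(m, n) :=
  \matrix_(i, j) (G j)^`M(i).

Lemma mul_jac n (G : 'I_n -> {mpoly R[m]}) P j : (P *m jac G) 0 j = ddir P (G j).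
Proof. by rewrite mxE; apply: eq_bigr => i _; rewrite mxE. Qed.

(** The kernel distribution of [A] is totally geodesic for the flat connection of affine space. *)
Definition autoparallel (n : nat) (A : 'M[{mpoly R[m]}]_(m, n)) :=
  forall P Q, P *m A = 0 -> Q *m A = 0 -> ddirv Q P *m A = 0.

Definition hessian (h : {mpoly R[m]}) : 'M[{mpoly R[m]}]_m := jac (fun j => h^`M(j)).

Lemma hessianC h i j : hessian h i j = hessian h j i.
Proof. by rewrite !mxE mderiv_comm. Qed.

Lemma trmx_hessian h : (hessian h)^T = hessian h.
Proof. by apply/matrixP => i j; rewrite mxE hessianC. Qed.

(** Symmetry of third derivatives: [ddir Q] of an entry of the Hessian is the [j]-th derivative of
    an entry of [Q A] without the terms in which [Q] is differentiated. *)
Lemma ddir_hessian Q h i j :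
  ddir Q (hessian h i j) = ((Q *m hessian h) 0 i)^`M(j) - (map_mx (mderiv j) Q *m hessian h) 0 i.
Proof.
apply/esym/eqP; rewrite subr_eq; apply/eqP.
rewrite [(Q *m _) 0 i]mxE (raddf_sum (mderiv j)) [(_ *m _) 0 i]mxE -big_split.
apply: eq_bigr => k _ /=; rewrite mderivM addrC; congr (_ * _ + _).
  by rewrite [RHS]mxE.
by congr (_ * _); rewrite !mxE (mderiv_comm k j) (mderiv_comm i j).
Qed.

(** Differentiate [P A = 0] along [Q]. By [ddir_hessian] and [Q A = 0], the terms in which [A] is
    differentiated are, up to sign, the pairing of [P A] with a derivative of [Q], which is zero. *)
Lemma autoparallel_hessian h : autoparallel (hessian h).
Proof.
move=> P Q PA QA; apply/rowP => j; rewrite [RHS]mxE.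
have := ddir_mulmx Q P (hessian h) j.
rewrite PA [(0 : 'rV_m) 0 j]mxE ddir0 => /esym.
rewrite [X in _ + X](_ : _ = 0) ?addr0 //.
rewrite (eq_bigr (fun i => - (P 0 i * (map_mx (mderiv j) Q *m hessian h) 0 i))) => [|i _].
  rewrite sumrN -[RHS]oppr0; congr (- _).
  have -> : \sum_i P 0 i * (map_mx (mderiv j) Q *m hessian h) 0 i
     = (P *m hessian h *m (map_mx (mderiv j) Q)^T) 0 0.
    rewrite -{2}trmx_hessian -mulmxA -trmx_mul mxE.
    by apply: eq_bigr => i _; rewrite [in RHS]mxE.
  by rewrite PA mul0mx mxE.
by rewrite ddir_hessian QA [(0 : 'rV_m) 0 i]mxE mderiv0 sub0r mulrN.
Qed.

End Autoparallel.

(** * Generic fibres contain affine spaces *)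

Section LinearFibres.

Variables (L : fieldType) (char0 : [pchar L] =i pred0) (m n : nat).
Variable G : 'I_n -> {mpoly L[m]}.
Let A := jac G.
Hypothesis autoA : autoparallel A.
Variables (d : {mpoly L[m]}) (S : 'M[L]_m) (N : 'M[{mpoly L[m]}]_m)
  (B : 'M[{mpoly L[m]}]_(n, m)).
Hypotheses (nz_d : d != 0) 
  (NAB : N + A *m B = d%:M) (NA : N *m A = 0) (NS : N *m mxC m S = d *: mxC m S)
  (SN : mxC m S *m N = N).

(* [d^2] times the derivative of the normalised kernel vector field [w N / d]. *)
Definition dnorm (Q : 'rV[{mpoly L[m]}]_m) (w : 'rV[L]_m) : 'rV[{mpoly L[m]}]_m :=
  d *: ddirv Q (mxC m w *m N) - ddir Q d *: (mxC m w *m N).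

(** Because [N S = d S], the normalised field [w N / d] has the constant image [w S] under [S]. *)
Lemma dnormS Q w : dnorm Q w *m mxC m S = 0.
Proof.
rewrite /dnorm mulmxBl -!scalemxAl -ddirv_mulC -mulmxA NS -scalemxAr.
have -> : mxC m w *m mxC m S = mxC m (w *m S) by rewrite /mxC map_mxM.
apply/rowP => i; rewrite !mxE ddirM ddirC; ring.
Qed.

(** This derivative lies in the kernel of [A] by autoparallelism and in the kernel of [S] by
    normalisation; the two kernels meet in zero. *)
Lemma dnorm_fibre w w' : dnorm (mxC m w' *m N) w = 0.
Proof.
have PA v : mxC m v *m N *m A = 0 by rewrite -mulmxA NA mulmx0.
apply: (kernel_meets_S nz_d NAB SN); last exact: dnormS.
by rewrite /dnorm mulmxBl -!scalemxAl PA autoA // !scaler0 subr0.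
Qed.

(** The field [P = w N] has [P(c) = d(c) w], and [P / d] is constant along itself by [dnorm_fibre].
    Since [P] annihilates each [G j], all Taylor coefficients of [G j] on the line through [c] with
    direction [P(c)] vanish in positive order; the parameter [1 / d(c)] gives the point [c + w]. *)
Lemma linear_fibres (c w : 'rV[L]_m) : d.@[c 0] != 0 -> w *m evmx c A = 0 ->
  forall j, (G j).@[(c + w) 0] = (G j).@[c 0].
Proof.
move=> nz_dc wA j; pose P := mxC m w *m N.
have Pc : evmx c P = d.@[c 0] *: w.
  by rewrite evmxM evmx_mxC (kernel_at NAB).
have PG : ddir P (G j) = 0.
  by rewrite -mul_jac -mulmxA NA mulmx0 mxE.
have dP i : d * ddir P (P 0 i) = ddir P d * P 0 i.
  by apply/eqP; rewrite -subr_eq0; have /rowP/(_ i) := dnorm_fibre w w; rewrite !mxE => /eqP.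
have := @mline_const L char0 m c P (G j) _ (d.@[c 0])^-1.
rewrite Pc scalerA mulVf // scale1r; apply => i.
rewrite (tdir_eq0 _ dP PG) ?meval0 // => q /eqP.
by rewrite mulf_eq0 (negPf nz_d) => /eqP.
Qed.

End LinearFibres.

Lemma meval_neq0 (L : fieldType) (char0 : [pchar L] =i pred0) (m : nat) (p : {mpoly L[m]}) :
  p != 0 -> exists c : 'rV[L]_m, p.@[c 0] != 0.
Proof.
move=> /eqP nz_p; apply: NNPP => p0; case: nz_p; apply: (meval_all0 char0) => c.
by apply/eqP; apply: contraT => nz_pc; case: p0; exists c.
Qed.

(** * Constancy of the kernel in rank at most one *)

Section RankOne.

Variables (L : fieldType) (char0 : [pchar L] =i pred0) (m n : nat).
Variable G : 'I_n -> {mpoly L[m]}.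
Hypotheses (autoG : autoparallel (jac G)) (rk1 : (rankF (jac G) <= 1)%N).

(* Fibres of [G] with distinct directions would be meeting hyperplanes, so [G] would be constant. *)
Lemma rank1_constant_kernel :
  exists2 c : 'rV[L]_m, (\rank (evmx c (jac G)) <= rankF (jac G))%N &
  forall w : 'rV[L]_m, w *m evmx c (jac G) = 0 -> mxC m w *m jac G = 0.
Proof.
have [d [S [N [B [nz_d rS NAB NA [NS SN]]]]]] := kernel_projection (jac G).
have fibre := linear_fibres char0 autoG nz_d NAB NA NS SN.
have [c nz_dc] := meval_neq0 char0 nz_d.
exists c => [|w wA]; first by apply: (rank_at nz_d rS NA NS).
apply/eqP; apply: contraT => /rV0Pn[j nz_wAj].
suff Gconst i : G i = (G i).@[c 0]%:MP.
  case/eqP: nz_wAj; rewrite mxE big1 // => i _.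
  by rewrite [jac _ _ _]mxE Gconst mderivC mulr0.
apply/eqP; rewrite -subr_eq0; apply/eqP.
(* The nonzero factors [d] and [(w A)_j] restrict the comparison to points [x] where neither
   vanishes. *)
suff /eqP : d * (mxC m w *m jac G) 0 j * (G i - (G i).@[c 0]%:MP) = 0.
  by rewrite !mulf_eq0 (negPf nz_d) (negPf nz_wAj) => /eqP.
apply: (meval_all0 char0) => x; rewrite !mevalM mevalB mevalC.
have [->|nz_dx] := eqVneq d.@[x 0] 0; first by rewrite !mul0r.
have [->|nz_wx] := eqVneq ((mxC m w *m jac G) 0 j).@[x 0] 0; first by rewrite mulr0 mul0r.
suff -> : (G i).@[x 0] = (G i).@[c 0] by rewrite subrr mulr0.
have le1 : (\rank (evmx x (jac G)) <= 1)%N.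
  by apply: leq_trans rk1; apply: (rank_at nz_d rS NA NS).
have nz_wAx : w *m evmx x (jac G) != 0.
  apply/rV0Pn; exists j; have -> : w *m evmx x (jac G) = evmx x (mxC m w *m jac G).
    by rewrite evmxM evmx_mxC.
  by rewrite mxE.
(* As [A(x)] has rank at most one and [w A(x)] is nonzero, some [c - x - a w] lies in the kernel at
   [x]. The fibre of [x] then contains [c - a w], which is also in the fibre of [c]. *)
have : ((c - x) *m evmx x (jac G) <= w *m evmx x (jac G))%MS.
  apply: submx_trans (submxMl _ _) _.
  by rewrite -(geq_leqif (mxrank_leqif_sup (submxMl w _))) rank_rV nz_wAx.
case/sub_rVP=> a /eqP; rewrite scalemxAl -subr_eq0 -mulmxBl => /eqP xker.
rewrite -(fibre x _ nz_dx xker) -[RHS](fibre c (- (a *: w)) nz_dc).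
  by congr (meval _ _); congr (_ 0); rewrite addrA (addrC x) subrK.
by rewrite mulNmx -scalemxAl wA scaler0 oppr0.
Qed.

End RankOne.

(** * Algebraic dependence and the tangent space of a cone *)

Lemma msize_prod_exp_le (R : idomainType) (k : nat) (I : finType) (F : I -> {mpoly R[k]})
    (e : I -> nat) (D : nat) :
  (forall i, (msize (F i) <= D)%N) -> (msize (\prod_i F i ^+ e i) <= (\sum_i e i * D).+1)%N.
Proof.
move=> FD; elim/big_ind2: _ => [|a x b y lex ley|i _]; first by rewrite msize1.
  have [->|nz_a] := eqVneq x 0; first by rewrite mul0r msize0.
  have [->|nz_b] := eqVneq y 0; first by rewrite mulr0 msize0.
  by rewrite msizeM //; lia.
elim: (e i) => [|l IHl]; first by rewrite expr0 msize1.
have [->|nz_F] := eqVneq (F i) 0; first by rewrite expr0n msize0.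
by rewrite exprS msizeM ?expf_neq0 //; move: (FD i); lia.
Qed.

(* Fewer than [M^n] coefficients are available for the [M^n] monomials with exponents below [M]. *)
Lemma algebraically_dependent (L : fieldType) (k n : nat) (F : 'I_n -> {mpoly L[k]}) :
  (k < n)%N -> exists2 f : {mpoly L[n]}, f != 0 & mcomp F f = 0.
Proof.
move=> lt_kn; pose D := \max_i msize (F i).
(* [T] exceeds every exponent in the composed monomials. The value of [M] ensures [T ^ k <= (2 * n *
   D.+1 * M) ^ k < M ^ k.+1 <= M ^ n]. *)
pose M := ((2 * n * D.+1) ^ k).+1; pose T := (n * (M * D)).+1.
pose mI (e : {ffun 'I_n -> 'I_M}) : 'X_{1..n} := [multinom (e i : nat) | i < n].
pose mJ (e : {ffun 'I_k -> 'I_T}) : 'X_{1..k} := [multinom (e i : nat) | i < k].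
have mI_inj : injective mI.
  move=> e e' /mnmP ee'; apply/ffunP => i; apply: val_inj.
  by have := ee' i; rewrite !mnmE.
pose A : 'M[L]_(_, _) := \matrix_(a < #|{ffun 'I_n -> 'I_M}|, b < #|{ffun 'I_k -> 'I_T}|)
  (mcomp F 'X_[mI (enum_val a)])@_(mJ (enum_val b)).
have lt_card : (#|{ffun 'I_k -> 'I_T}| < #|{ffun 'I_n -> 'I_M}|)%N.
  rewrite !card_ffun !card_ord.
  have le1 : (T ^ k <= (2 * n * D.+1) ^ k * M ^ k)%N.
    have le_T : (T <= 2 * n * D.+1 * M)%N.
      rewrite /T -mulnA; have M_gt0 : (0 < M)%N by [].
      by move: (M) M_gt0 => M0 M0_gt0; nia.
    by rewrite -expnMn; case: (posnP k) => [->|k_gt0]; rewrite ?expn0 ?leq_exp2r.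
  apply: leq_ltn_trans le1 _; apply: (@leq_trans (M ^ k.+1)); last exact: leq_pexp2l.
  by rewrite expnS ltn_mul2r expn_gt0 /= ltnSn.
have /rowV0Pn[v /sub_kermxP vA nz_v] : kermx A != 0.
  rewrite -mxrank_eq0 mxrank_ker; have := rank_leq_col A; lia.
pose f := \sum_a v 0 a *: 'X_[mI (enum_val a)].
have fI a : f@_(mI (enum_val a)) = v 0 a.
  rewrite linear_sum (bigD1 a) //= big1 => [|b ne_ba].
    by rewrite mcoeffZ mcoeffX eqxx mulr1 addr0.
  rewrite mcoeffZ mcoeffX (inj_eq mI_inj) (inj_eq enum_val_inj).
  by rewrite (negPf ne_ba) mulr0.
exists f.
  have /rV0Pn[a nz_va] := nz_v; apply: contraNneq nz_va => f0.
  by rewrite -fI f0 mcoeff0.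
apply/mpolyP => u; rewrite mcoeff0 /mcomp /f [f in f@_u]linear_sum /= (raddf_sum (mcoeff u)).
have [/forallP lt_u|] := boolP [forall i, (u i < T)%N].
  pose g : {ffun 'I_k -> 'I_T} := [ffun i => Ordinal (lt_u i)].
  have -> : u = mJ (enum_val (enum_rank g)).
    by rewrite enum_rankK; apply/mnmP => i; rewrite mnmE ffunE.
  have /rowP/(_ (enum_rank g)) := vA; rewrite !mxE => vA0; rewrite -[RHS]vA0.
  apply: eq_bigr => a _. by rewrite mxE /= comp_mpolyZ mcoeffZ.
rewrite negb_forall => /existsP[i]; rewrite -leqNgt => le_Tu.
apply: big1 => a _ /=; rewrite comp_mpolyZ mcoeffZ comp_mpolyX.
rewrite memN_msupp_eq0 ?mulr0 //; apply: msize_mdeg_ge.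
have le_D j : (msize (tnth [tuple F i | i < n] j) <= D)%N.
  by rewrite tnth_mktuple; apply: (leq_bigmax j).
apply: leq_trans (msize_prod_exp_le _ le_D) _.
have le_u : (u i <= mdeg u)%N by rewrite mdegE (bigD1 i) //= leq_addr.
apply: leq_trans le_u; apply: leq_trans le_Tu; rewrite /T ltnS.
rewrite -[n in (_ <= n * _)%N]card_ord -sum_nat_const; apply: leq_sum => j _.
by rewrite mnmE leq_mul2r ltnW ?orbT.
Qed.

Section ConeTangent.

Variables (L : fieldType) (char0 : [pchar L] =i pred0) (m : nat).

(** A generic point can be moved inside its linear fibre into the constant space [kermx S], whose
    dimension is the rank of [jac G]. Restricted to that space, the chosen components are
    polynomials in fewer than [n] variables, so they are dependent. *)
Lemma fibred_dependent (n k : nat) (G : 'I_k -> {mpoly L[m]}) (i_ : 'I_n -> 'I_k) :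
  autoparallel (jac G) -> (rankF (jac G) < n)%N ->
  exists2 f : {mpoly L[n]}, f != 0 & mcomp (G \o i_) f = 0.
Proof.
move=> autoG lt_rn.
have [d [S [N [B [nz_d rS NAB NA [NS SN]]]]]] := kernel_projection (jac G).
have fibre := linear_fibres char0 autoG nz_d NAB NA NS SN.
pose D := row_base (kermx S).
have lt_kn : (\rank (kermx S) < n)%N.
  by rewrite mxrank_ker; have := rank_leq_row (fracmx (jac G)); lia.
pose lin j := \sum_a D a j *: 'X_a : {mpoly L[\rank (kermx S)]}.
have [f nz_f fF] := algebraically_dependent (fun i => mcomp lin (G (i_ i))) lt_kn.
exists f => //.
suff /eqP : d * mcomp (G \o i_) f = 0.
  by rewrite mulf_eq0 (negPf nz_d) => /eqP.
apply: (meval_all0 char0) => c; rewrite mevalM.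
have [->|nz_dc] := eqVneq d.@[c 0] 0; first by rewrite mul0r.
apply/eqP; rewrite mulf_eq0 (negPf nz_dc) /=; apply/eqP.
pose w := - (d.@[c 0])^-1 *: (c *m evmx c N).
have wA : w *m evmx c (jac G) = 0.
  by rewrite -scalemxAl -mulmxA -evmxM NA /evmx map_mx0 mulmx0 scaler0.
have : ((c + w)%R <= D)%MS.
  rewrite eq_row_base; apply/sub_kermxP; rewrite mulmxDl -scalemxAl -mulmxA.
  have -> : evmx c N *m S = d.@[c 0] *: S.
    by rewrite -{1}(evmx_mxC c S) -evmxM NS /evmx map_mxZ -/(evmx c _) evmx_mxC.
  by rewrite -scalemxAr scalerA mulNr mulVf // scaleN1r subrr.
case/submxP=> z cw; have /(congr1 (meval (z 0))) := fF.
rewrite meval0 !meval_mcomp => E0; rewrite -[RHS]E0; apply: meval_eq => i.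
rewrite meval_mcomp -(fibre c w nz_dc wA) cw; apply: meval_eq => j.
rewrite raddf_sum mxE; apply: eq_bigr => a _ /=.
by rewrite mevalZ mevalXU mulrC.
Qed.

Variable h : {mpoly L[m]}.

(** Row [i] of [M] consists of the derivatives of the [i]-th component of [grad h] and of that
    component. If [grad h] were outside the row space of the Hessian, [M] would have larger rank
    than it, so the components at independent rows of [M] would satisfy a nonzero relation [f].
    Differentiating a relation and using the cone property shows that the vector of its partial
    derivatives at [grad h] annihilates these independent rows. Relations are thus closed under
    derivation, and all are zero. *)
Lemma cone_tangent :
  (forall f : {mpoly L[m]}, mcomp (fun i => h^`M(i)) f = 0 ->
     forall s (c : 'rV[L]_m), f.@[fun i => s * h^`M(i).@[c 0]] = 0) ->
  (fracmx (grad h) <= fracmx (hessian h))%MS.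
Proof.
move=> cone; apply: contraT => notin.
pose M := (col_mx (hessian h) (grad h))^T.
have lt_r : (rankF (hessian h) < rankF M)%N.
  rewrite /M -map_trmx mxrank_tr map_col_mx -addsmxE.
  rewrite ltn_neqAle mxrankS ?addsmxSl // andbT.
  apply: contraNneq notin => eq_r; apply: submx_trans (addsmxSr (fracmx (hessian h)) _) _.
  by rewrite -(geq_leqif (mxrank_leqif_sup (addsmxSl _ _))) eq_r.
pose i_ := maxrankfun (fracmx M).
have [f /eqP nz_f f0] := fibred_dependent i_ (@autoparallel_hessian _ _ h) lt_r.
case: nz_f; move: f f0.
apply: (@mderiv_closed_eq0 _ char0 _ (fun f => mcomp ((fun i => h^`M(i)) \o i_) f = 0)
  (fun i => (h^`M(i_ i)).@[fun=> 0])).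
  move=> p i p0; pose g := \row_i mcomp ((fun i => h^`M(i)) \o i_) p^`M(i).
  suff /rowP/(_ i) : g = 0 by rewrite !mxE.
  apply: map_tofrac_inj; rewrite map_mx0; apply/eqP.
  rewrite -(mulmx_free_eq0 _ (maxrowsub_free (fracmx M))).
  have -> : rowsub (maxrankfun (fracmx M)) (fracmx M) = fracmx (rowsub i_ M).
    by rewrite map_mxsub.
  rewrite -map_mxM; apply/eqP; rewrite [_ *m _](_ : _ = 0) ?map_mx0 //.
  apply/rowP => j; rewrite mxE [RHS]mxE.
  case: (splitP j) => [a def_j | a def_j].
    have -> : j = lshift 1 a by apply: val_inj.
    have := congr1 (mderiv a) p0; rewrite mderiv0 mderiv_mcomp => E0; rewrite -[RHS]E0.
    by apply: eq_bigr => b _; rewrite !mxE (unsplitK (inl a)) !mxE /= mderiv_comm.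
  have -> : j = rshift m a by apply: val_inj.
  apply: (meval_all0 char0) => c.
  pose y : 'rV[L]_(rankF M) := \row_i (h^`M(i_ i)).@[c 0].
  (* By the cone hypothesis [p] vanishes on all [(1 + t) y]; the derivative at [t = 0] is the Euler
     relation for the last column of [M]. *)
  have : mline y y p = 0.
    apply: (poly_eq0_char0 char0) => t; rewrite horner_mline.
    pose q := mcomp (fun i => 'X_(i_ i) : {mpoly L[m]}) p.
    have /cone/(_ (1 + t) c) : mcomp (fun i => h^`M(i)) q = 0.
      apply: (meval_all0 char0) => x; rewrite !meval_mcomp.
      have /(congr1 (meval (x 0))) := p0; rewrite meval0 meval_mcomp => E0; rewrite -[RHS]E0.
      by apply: meval_eq => b; rewrite mevalXU.
    rewrite meval_mcomp => E0; rewrite -[RHS]E0; apply: meval_eq => b.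
    by rewrite mevalXU !mxE mulrDl mul1r.
  move/(congr1 (fun q => q^`().[0])); rewrite deriv_mline deriv0 horner0.
  rewrite horner_mline scale0r addr0 => E0; rewrite -[RHS]E0; rewrite !raddf_sum.
  apply: eq_bigr => b _ /=; rewrite !mevalM !mxE (unsplitK (inr a)) !mxE mevalC.
  rewrite meval_mcomp mulrC; congr (_ * _).
  by apply: meval_eq => b'; rewrite mxE.
move=> p /(congr1 (meval (fun=> 0))); rewrite meval0 meval_mcomp => E0; rewrite -[RHS]E0.
by apply: meval_eq.
Qed.

End ConeTangent.

(** * Constancy of the kernel in rank two *)

Section RankTwo.

Variables (L : fieldType) (char0 : [pchar L] =i pred0) (m : nat).

Lemma rank_constant_kernel (n p : nat) (A : 'M[{mpoly L[m]}]_(m, n)) (W : 'M[L]_(p, m)) :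
  mxC m W *m A = 0 -> (\rank W + rankF A <= m)%N.
Proof.
move=> WA; have -> : \rank W = rankF (mxC m W).
  by rewrite tofrac_mxC mxrank_map.
by apply: mulmx0_rank_max; rewrite -map_mxM WA map_mx0.
Qed.

Lemma mxC_kermx_eq0 (n p : nat) (A : 'M[{mpoly L[m]}]_(m, n)) (M : 'M[L]_(m, p)) :
  (forall w : 'rV[L]_m, w *m M = 0 -> mxC m w *m A = 0) -> mxC m (kermx M) *m A = 0.
Proof.
move=> ker; apply/row_matrixP => i; rewrite row_mul row0.
have -> : row i (mxC m (kermx M)) = mxC m (row i (kermx M)) by rewrite /mxC map_row.
by apply: ker; rewrite -row_mul mulmx_ker row0.
Qed.

(** On the line from [c] to [x], the combination [q = d(c) p - p(c) d] satisfies [d q' = d' q] and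
    vanishes at the parameter 0, where [d] does not. Comparing coefficients kills those of [q] one
    after another. *)
Lemma proportional_of_wronskian (p d : {mpoly L[m]}) (c x : 'rV[L]_m) :
  (forall v, d * ddir (mxC m v) p = ddir (mxC m v) d * p) -> d.@[c 0] != 0 ->
  d.@[c 0] * p.@[x 0] = p.@[c 0] * d.@[x 0].
Proof.
move=> pd nz_dc; pose f := mline c (x - c).
pose q := d.@[c 0] *: f p - p.@[c 0] *: f d.
have f0 r : (f r)`_0 = r.@[c 0].
  by rewrite -horner_coef0 horner_mline scale0r addr0.
have fM r s : f (r * s) = f r * f s by rewrite /f /mline rmorphM.
suff q0 : q = 0.
  apply/eqP; rewrite -subr_eq0; have /(congr1 (horner^~ 1)) := q0.
  by rewrite /q !hornerE !horner_mline scale1r (addrC c) subrK => ->.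
have dq : f d * q^`() = (f d)^`() * q.
  rewrite /q derivB !derivZ !deriv_mline -/f mulrBr mulrBr -!scalerAr -!fM pd.
  by rewrite [d * _]mulrC.
apply/polyP => k; rewrite coef0; have [l] := ubnP k; elim: l k => // l IHl [|k] lt_kl.
  by rewrite coefB !coefZ !f0 mulrC subrr.
have /(congr1 (fun r : {poly L} => r`_k)) := dq; rewrite !coefM.
rewrite [RHS]big1 => [|i _]; last by rewrite IHl ?mulr0 //; have := leq_subr i k; lia.
rewrite big_ord_recl big1 ?addr0 => [|i _]; last first.
  by rewrite coef_deriv IHl ?mul0rn ?mulr0 //= /bump /=; have := ltn_ord i; lia.
rewrite subn0 coef_deriv f0 -mulr_natl => /eqP.
by rewrite !mulf_eq0 (negPf nz_dc) (negPf (natf_neq0_char0 char0 _)) => /eqP.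
Qed.

Variable h : {mpoly L[m]}.
Let A := hessian h.
Let H := grad h.
Hypothesis rk2 : rankF A = 2%N.
(** The quotient [e / a] acts as an Euler field: the derivative of [grad h] along it is [grad h]. *)
Variables (e : 'rV[{mpoly L[m]}]_m) (a : {mpoly L[m]}).
Hypotheses (nz_a : a != 0) (eA : e *m A = a *: H).
Variables (d : {mpoly L[m]}) (S : 'M[L]_m) (N : 'M[{mpoly L[m]}]_m) (B : 'M[{mpoly L[m]}]_m).
Hypotheses (nz_d : d != 0) (rS : \rank S = (m - rankF A)%N)
  (NAB : N + A *m B = d%:M) (NA : N *m A = 0) (NS : N *m mxC m S = d *: mxC m S)
  (SN : mxC m S *m N = N).

Let autoA : autoparallel A := @autoparallel_hessian _ _ h.

Lemma mulA_tr (P Q : 'rV[{mpoly L[m]}]_m) : P *m A = 0 -> Q *m A *m P^T = 0.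
Proof.
by move=> PA; rewrite -mulmxA -[A](trmx_hessian h) -trmx_mul PA trmx0 mulmx0.
Qed.

(** Pairing [e A = a H] with [P] gives zero on the left, as [A] is symmetric. *)
Lemma kernel_perp_grad (P : 'rV[{mpoly L[m]}]_m) : P *m A = 0 -> P *m H^T = 0.
Proof.
move=> PA; have := mulA_tr e PA; rewrite eA -scalemxAl => aHP.
have : a *: (P *m H^T) = 0.
  by apply: trmx_inj; rewrite trmx0 linearZ /= trmx_mul trmxK.
exact: scalemx_eq0.
Qed.

Lemma ddir_gradE (Q : 'rV[{mpoly L[m]}]_m) i : ddir Q (H 0 i) = (Q *m A) 0 i.
Proof. by rewrite mul_jac mxE. Qed.

Lemma ddirv_mul_grad (P Q : 'rV[{mpoly L[m]}]_m) : P *m H^T = 0 ->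
  ddirv Q P *m H^T = - (Q *m A *m P^T).
Proof.
move=> PH; apply/rowP => j; rewrite ord1.
have := ddir_mulmx Q P H^T 0.
rewrite PH [(0 : 'rV_1) 0 0]mxE ddir0 => /esym/eqP; rewrite addr_eq0 => /eqP->.
rewrite [RHS]mxE mxE; congr (- _); apply: eq_bigr => i _.
by rewrite [H^T _ _]mxE ddir_gradE mulrC [P^T _ _]mxE.
Qed.

Lemma nz_grad : H != 0.
Proof.
apply: contra_eq_neq rk2 => H0; rewrite (_ : A = 0) ?map_mx0 ?mxrank0 //.
apply/matrixP => i j; rewrite !mxE; have /rowP/(_ j) := H0.
by rewrite !mxE => ->; rewrite mderiv0.
Qed.

(* Otherwise the level sets of [h] would be totally geodesic, so that [rank1_constant_kernel]
   would apply to [h] itself and make [H] proportional to a constant vector. *)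
Lemma euler_nonisotropic : (e *m H^T) 0 0 != 0.
Proof.
apply/eqP => eH0.
pose G : 'I_1 -> {mpoly L[m]} := fun=> h.
have jacG : jac G = H^T by apply/matrixP => i j; rewrite !mxE.
have eH : e *m H^T = 0 by apply/matrixP => i j; rewrite !ord1 eH0 mxE.
have NH : N *m H^T = 0.
  apply/row_matrixP => i; rewrite row_mul row0 kernel_perp_grad //.
  by rewrite -row_mul NA row0.
(* By a dimension count: [N] contributes at least [m - 2], and [e] is not in its span because
   [e A = a H] is nonzero. *)
have kerH : (kermx (fracmx H^T) <= fracmx (col_mx N e))%MS.
  have sub : (fracmx (col_mx N e) <= kermx (fracmx H^T))%MS.
    by apply/sub_kermxP; rewrite -map_mxM mul_col_mx NH eH col_mx0 map_mx0.
  rewrite -(geq_leqif (mxrank_leqif_sup sub)) mxrank_ker map_col_mx -addsmxE.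
  have rH : \rank (fracmx H^T) = 1%N.
    rewrite -map_trmx mxrank_tr rank_rV.
    by rewrite -(map_mx0 (@FracField.tofrac _)) (inj_eq (@map_tofrac_inj _ _ _)) nz_grad.
  have rN : (m - 2 <= \rank (fracmx N))%N.
    rewrite -rk2 -rS.
    have -> : \rank S = rankF (d *: mxC m S).
      rewrite map_mxZ mxrank_scale_nz ?tofrac_eq0 // tofrac_mxC.
      by rewrite mxrank_map.
    by rewrite -NS map_mxM mxrankM_maxl.
  suff : (\rank (fracmx N) < \rank (fracmx N + fracmx e)%MS)%N by rewrite rH; lia.
  rewrite ltn_neqAle mxrankS ?addsmxSl // andbT.
  apply/eqP => eq_r.
  have : (fracmx e <= fracmx N)%MS.
    apply: submx_trans (addsmxSr (fracmx N) _) _.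
    by rewrite -(geq_leqif (mxrank_leqif_sup (addsmxSl _ _))) eq_r.
  case/submxP => y ey; have /eqP : fracmx (e *m A) = 0.
    by rewrite map_mxM ey -mulmxA -map_mxM NA map_mx0 mulmx0.
  rewrite -(map_mx0 (@FracField.tofrac _)) (inj_eq (@map_tofrac_inj _ _ _)) eA.
  by move/eqP/(scalemx_eq0 nz_a)/eqP; rewrite (negPf nz_grad).
(* It remains to see [Q A P^T = 0]. Over the fraction field [Q] is a combination of the rows of [N]
   and of [e], so [Q A] is a multiple of [H], which is orthogonal to [P]. *)
have autoG : autoparallel (jac G).
  rewrite jacG => P Q PH QH; rewrite ddirv_mul_grad //.
  apply/eqP; rewrite oppr_eq0; apply/eqP; apply: map_tofrac_inj.
  rewrite map_mx0 map_mxM.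
  have /submxP[y Qy] : (fracmx Q <= fracmx (col_mx N e))%MS.
    by apply: submx_trans kerH; apply/sub_kermxP; rewrite -map_mxM QH map_mx0.
  rewrite map_mxM Qy -[y *m _ *m _]mulmxA -map_mxM mul_col_mx NA eA -mulmxA -map_mxM.
  rewrite mul_col_mx mul0mx -scalemxAl.
  have -> : H *m P^T = 0 by rewrite -[H]trmxK -trmx_mul PH trmx0.
  by rewrite scaler0 col_mx0 map_mx0 mulmx0.
have [c _ kerc] := rank1_constant_kernel char0 autoG (rank_leq_col _).
(* Differentiating the identity [w . H = 0] gives [w A = 0]. The space of such constant [w] has
   dimension at least [m - 1], against the rank two of [A]. *)
have kerA : forall w : 'rV[L]_m, w *m evmx c (jac G) = 0 -> mxC m w *m A = 0.
  move=> w /kerc; rewrite jacG => wH; apply/rowP => j.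
  rewrite [RHS]mxE mul_jac -[h^`M(j)](_ : H 0 j = _); last by rewrite mxE.
  have := congr1 (fun M : 'rV[{mpoly L[m]}]_1 => (M 0 0)^`M(j)) wH.
  rewrite [(0 : 'rV_1) 0 0]mxE mderiv0 => E0; rewrite -[RHS]E0.
  rewrite [in RHS]mxE (raddf_sum (mderiv j)) /ddir; apply: eq_bigr => i _ /=.
  by rewrite mderivM !mxE mderivC mul0r add0r mderiv_comm.
have := rank_constant_kernel (mxC_kermx_eq0 kerA).
rewrite mxrank_ker rk2; have := rank_leq_col (evmx c (jac G)).
have := rank_leq_row (fracmx A); rewrite rk2; lia.
Qed.


Let fibre := linear_fibres char0 autoA nz_d NAB NA NS SN.
(** In the variable [v] this is a linear endomorphism: [d(c)^2] times the differential at [c] of the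
    field [w N / d]. *)
Let u (c w v : 'rV[L]_m) : 'rV[L]_m := evmx c (dnorm d N (mxC m v) w).

Lemma ddir_mcomp (k : nat) (Q : 'rV[{mpoly L[m]}]_m) (F : 'I_k -> {mpoly L[m]}) f :
  ddir Q (mcomp F f) = \sum_i mcomp F f^`M(i) * ddir Q (F i).
Proof.
rewrite /ddir; under eq_bigr do rewrite mderiv_mcomp mulr_sumr.
rewrite exchange_big; apply: eq_bigr => i _; rewrite mulr_sumr.
by apply: eq_bigr => j _; rewrite mulrCA.
Qed.

Lemma mul_evjac (c v : 'rV[L]_m) i :
  (v *m evmx c A) 0 i = (ddir (mxC m v) h^`M(i)).@[c 0].
Proof.
rewrite -(@mul_jac _ _ _ (fun j => h^`M(j))) -[v in LHS](evmx_mxC c) -evmxM.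
by rewrite [LHS]mxE.
Qed.

(* The map [x |-> x + t P(x)] preserves [H]; for [t = - d(c) / l] its differential at [c]
   maps [v] into the kernel. *)
Lemma dnorm_nilpotent (c w v : 'rV[L]_m) (l : L) :
  d.@[c 0] != 0 -> l != 0 -> u c w v = l *: v -> v *m evmx c A = 0.
Proof.
move=> nz_dc nz_l uv; pose P := mxC m w *m N.
have PA x : evmx x P *m evmx x A = 0.
  by rewrite -evmxM -mulmxA NA mulmx0 /evmx map_mx0.
(* [P(x)] is in the kernel at [x], so [x + t P(x)] is in the fibre of [x] whenever [d(x)] is
   nonzero. *)
have shift t i : mcomp (fun j => 'X_j + t *: P 0 j) h^`M(i) = h^`M(i).
  apply/eqP; rewrite -subr_eq0.
  suff /eqP : d * (mcomp (fun j => 'X_j + t *: P 0 j) h^`M(i) - h^`M(i)) = 0.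
    by rewrite mulf_eq0 (negPf nz_d).
  apply: (meval_all0 char0) => x; rewrite mevalM mevalB meval_mcomp.
  have [->|nz_dx] := eqVneq d.@[x 0] 0; first by rewrite mul0r.
  rewrite -(fibre (w := t *: evmx x P) nz_dx) -?scalemxAl ?PA ?scaler0 //.
  apply/eqP; rewrite mulf_eq0 subr_eq0; apply/orP; right; apply/eqP.
  by apply: meval_eq => j; rewrite mevalD mevalXU mevalZ !mxE.
pose t := - (d.@[c 0] / l); pose x := c + t *: evmx c P.
(* [H] is constant on the whole line through [c] with direction [P(c)], in particular to first order
   at its point [x]. *)
have Px : evmx c P *m evmx x A = 0.
  apply/rowP => i; rewrite mul_evjac [RHS]mxE.
  have : mline x (evmx c P) h^`M(i) = (h^`M(i).@[c 0])%:P.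
    apply/eqP; rewrite -subr_eq0; apply/eqP; apply: (poly_eq0_char0 char0) => s.
    rewrite hornerD hornerN hornerC horner_mline -addrA -scalerDl.
    by rewrite fibre ?subrr // -scalemxAl PA scaler0.
  move/(congr1 (fun q => q^`().[0])); rewrite deriv_mline derivC horner0 horner_mline.
  by rewrite scale0r addr0.
(* The value of [t] is the one for which the term [l v] cancels [v], leaving a multiple of
   [P(c)]. *)
have vP : v + t *: evmx c (ddirv (mxC m v) P) = (- ((ddir (mxC m v) d).@[c 0] / l)) *: evmx c P.
  have := uv; rewrite /u /dnorm -/P => /rowP dP; apply/rowP => j.
  have := dP j; rewrite !mxE mevalB !mevalM; move/(canRL (subrK _)) => Ej.
  by rewrite /t mulNr [_ / l * _]mulrAC Ej; field.
apply/rowP => i; rewrite [RHS]mxE mul_evjac -{1}(shift t i) ddir_mcomp raddf_sum.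
have -> : \sum_j (mcomp (fun j => 'X_j + t *: P 0 j) h^`M(i)^`M(j)
     * ddir (mxC m v) ('X_j + t *: P 0 j)).@[c 0]
   = ((v + t *: evmx c (ddirv (mxC m v) P)) *m evmx x A) 0 i.
  rewrite mxE; apply: eq_bigr => j _; rewrite mevalM mulrC; congr (_ * _).
    rewrite ddir_is_additive mevalD -mul_mpolyC ddirM ddirC mul0r add0r mevalM mevalC.
    rewrite !mxE; congr (_ + _); rewrite /ddir (bigD1 j) //= big1 => [|k ne_kj].
      by rewrite mderivX mnm1E eqxx scale1r -{1}[U_(j)%MM]add0m addmK mpolyX0
         mulr1 addr0 mxE mevalC.
    by rewrite mderivX mnm1E eq_sym (negPf ne_kj) scale0r mulr0.
  rewrite meval_mcomp !mxE; apply: meval_eq => k.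
  by rewrite mevalD mevalXU mevalZ !mxE.
by rewrite vP -scalemxAl Px scaler0 mxE.
Qed.

Lemma dnormE (Q : 'rV[{mpoly L[m]}]_m) w i : dnorm d N Q w 0 i =
  d * ddir Q ((mxC m w *m N) 0 i) - ddir Q d * (mxC m w *m N) 0 i.
Proof. by rewrite /dnorm; move: (mxC m w *m N) => P; rewrite !mxE. Qed.

Lemma dnorm_evE c w v i : u c w v 0 i =
  d.@[c 0] * (ddir (mxC m v) ((mxC m w *m N) 0 i)).@[c 0]
  - (ddir (mxC m v) d).@[c 0] * ((mxC m w *m N) 0 i).@[c 0].
Proof. by rewrite [LHS]mxE dnormE mevalB !mevalM. Qed.

Lemma dnorm_evD c w v v' : u c w (v + v') = u c w v + u c w v'.
Proof.
have addE (x y : 'rV[L]_m) i : (x + y) 0 i = x 0 i + y 0 i by rewrite mxE.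
apply/rowP => i; rewrite addE.
apply/esym/(etrans (congr2 +%R (dnorm_evE c w v i) (dnorm_evE c w v' i)))/esym/(etrans (dnorm_evE _ _ _ _)).
have -> : mxC m (v + v') = mxC m v + mxC m v' by rewrite /mxC map_mxD.
by rewrite !ddirDl !mevalD; ring.
Qed.

Lemma dnorm_evZ c w b v : u c w (b *: v) = b *: u c w v.
Proof.
have scaleE (x : 'rV[L]_m) i : (b *: x) 0 i = b * x 0 i by rewrite mxE.
apply/rowP => i; rewrite scaleE.
apply/esym/(etrans (congr1 ( *%R b) (dnorm_evE c w v i)))/esym/(etrans (dnorm_evE _ _ _ _)).
have -> : mxC m (b *: v) = b%:MP *: mxC m v.
  by apply/rowP => j; rewrite !mxE mpolyCM.
by rewrite !ddirZl !mevalM !mevalC; ring.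
Qed.

Lemma dnorm_at c w (Q : 'rV[{mpoly L[m]}]_m) :
  evmx c (dnorm d N Q w) = u c w (evmx c Q).
Proof.
have ddirQ p : (ddir Q p).@[c 0] = (ddir (mxC m (evmx c Q)) p).@[c 0].
  by rewrite !raddf_sum; apply: eq_bigr => i _ /=; rewrite !mevalM !mxE mevalC.
apply/rowP => i; rewrite [LHS]mxE dnormE mevalB !mevalM dnorm_evE.
by rewrite !ddirQ.
Qed.

(** As for [dnorm_fibre], it suffices to see that the derivative of [P = w N] along [e] is in the
    kernel of [A]. By [ddir_hessian] and [e A = a H], the derivatives of [A] along [e] are made of
    multiples of [H] and [A] and of a product with [A]; pairing with [P] kills each of them. *)
Lemma dnorm_euler w : dnorm d N e w = 0.
Proof.
have PA : mxC m w *m N *m A = 0 by rewrite -mulmxA NA mulmx0.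
apply: (kernel_meets_S nz_d NAB SN); last exact: dnormS NS _ _.
rewrite /dnorm mulmxBl -!scalemxAl PA scaler0 subr0.
set P := mxC m w *m N; apply/rowP => j.
have := ddir_mulmx e P A j; rewrite PA [(0 : 'rV_m) 0 j]mxE ddir0.
rewrite [X in _ + X](_ : _ = 0); first by rewrite addr0 !mxE => <-; rewrite mulr0.
have PH : \sum_i P 0 i * H 0 i = 0.
  have /matrixP/(_ 0 0) := kernel_perp_grad PA; rewrite !mxE => E0.
  by rewrite -[RHS]E0; apply: eq_bigr => i _; rewrite [H^T _ _]mxE.
have Pj : \sum_i P 0 i * A i j = 0.
  by have /rowP/(_ j) := PA; rewrite !mxE.
have PeA : \sum_i P 0 i * (map_mx (mderiv j) e *m A) 0 i = 0.
  have /matrixP/(_ 0 0) := mulA_tr (map_mx (mderiv j) e) PA; rewrite mxE [RHS]mxE => E0.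
  by rewrite -[RHS]E0; apply: eq_bigr => i _; rewrite mulrC [P^T _ _]mxE.
transitivity (a^`M(j) * (\sum_i P 0 i * H 0 i) + a * (\sum_i P 0 i * A i j)
   - \sum_i P 0 i * (map_mx (mderiv j) e *m A) 0 i); last first.
  by rewrite PH Pj PeA !mulr0 addr0 subr0.
rewrite !mulr_sumr -big_split -sumrB; apply: eq_bigr => i _.
rewrite ddir_hessian eA [(a *: H) 0 i]mxE mderivM -/A.
have -> : A i j = (H 0 i)^`M(j) by rewrite !mxE mderiv_comm.
by rewrite /=; ring.
Qed.

(** Differentiating [P . H = 0] along [v] leaves [v A P^T], which vanishes for a kernel field
    [P]. *)
Lemma dnorm_ev_grad c w v : u c w v *m (evmx c H)^T = 0.
Proof.
have PA : mxC m w *m N *m A = 0 by rewrite -mulmxA NA mulmx0.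
have : dnorm d N (mxC m v) w *m H^T = 0.
  rewrite /dnorm mulmxBl -!scalemxAl ddirv_mul_grad kernel_perp_grad //.
  by rewrite mulA_tr // oppr0 !scaler0 subrr.
by move/(congr1 (evmx c)); rewrite evmxM /evmx map_mx0 map_trmx.
Qed.

(** The endomorphism [u c w] vanishes on the kernel at [c] and on [e(c)], and its image lies in the
    space [X] of vectors killed by [S] and orthogonal to [H(c)]. As [X] is at most a line, [u c w]
    acts on it by a scalar. A nonzero scalar would put [X] in the kernel of [A(c)] by
    [dnorm_nilpotent], but that kernel meets the kernel of [S] trivially. *)
Lemma dnorm_ev_eq0 (c w v : 'rV[L]_m) :
  d.@[c 0] != 0 -> ((e *m H^T) 0 0).@[c 0] != 0 -> u c w v = 0.
Proof.
move=> nz_dc nz_tc; set Nc := evmx c N; set Hc := evmx c H; set ec := evmx c e.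
have NSc : Nc *m S = d.@[c 0] *: S.
  by rewrite -{1}(evmx_mxC c S) -evmxM NS /evmx map_mxZ -/(evmx c _) evmx_mxC.
have NHc : Nc *m Hc^T = 0.
  rewrite map_trmx -evmxM (_ : N *m H^T = 0) /evmx ?map_mx0 //.
  apply/row_matrixP => i; rewrite row_mul row0 kernel_perp_grad //.
  by rewrite -row_mul NA row0.
have u0 : u c w 0 = 0 by have := dnorm_evZ c w 0 0; rewrite !scale0r.
have uN x : u c w (x *m Nc) = 0.
  by rewrite -[x](evmx_mxC c) -evmxM -dnorm_at (dnorm_fibre autoA nz_d NAB NA NS SN) /evmx map_mx0.
have uSc x : u c w x *m S = 0.
  by rewrite -(evmx_mxC c S) -evmxM (dnormS NS) /evmx map_mx0.
have proj_S x : (x - (d.@[c 0])^-1 *: (x *m Nc)) *m S = 0.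
  by rewrite mulmxBl -scalemxAl -mulmxA NSc -scalemxAr scalerA mulVf // scale1r subrr.
have proj_H x : (x - (d.@[c 0])^-1 *: (x *m Nc)) *m Hc^T = x *m Hc^T.
  by rewrite mulmxBl -scalemxAl -mulmxA NHc mulmx0 scaler0 subr0.
pose e' := ec - (d.@[c 0])^-1 *: (ec *m Nc).
have tE : (e' *m Hc^T) 0 0 = ((e *m H^T) 0 0).@[c 0].
  by rewrite proj_H map_trmx -evmxM mxE.
have ue' : u c w e' = 0.
  rewrite /e' -scaleNr dnorm_evD dnorm_evZ uN scaler0 addr0 -dnorm_at dnorm_euler.
  by rewrite /evmx map_mx0.
pose X := (kermx S :&: kermx Hc^T)%MS.
(* The kernel of [S] is a plane, and it contains [e'], which is not orthogonal to [H(c)]. *)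
have rX : (\rank X <= 1)%N.
  have : (\rank X < \rank (kermx S))%N.
    rewrite ltn_neqAle mxrankS ?capmxSl // andbT; apply: contraNneq nz_tc => eq_r.
    have : (e' <= X)%MS.
      apply: (@submx_trans _ _ _ _ _ _ (kermx S)); first by apply/sub_kermxP; apply: proj_S.
      by rewrite -(geq_leqif (mxrank_leqif_sup (capmxSl _ _))) eq_r.
    by rewrite sub_capmx => /andP[_ /sub_kermxP e'H]; rewrite -tE e'H mxE.
  by rewrite mxrank_ker rS rk2; lia.
have uX x : (x <= X)%MS -> u c w x = 0.
  have [->//|nz_x] := eqVneq x 0 => xX.
  have : (u c w x <= x)%MS.
    apply: (@submx_trans _ _ _ _ _ _ X).
      by rewrite sub_capmx; apply/andP; split; apply/sub_kermxP; rewrite ?uSc ?dnorm_ev_grad.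
    by rewrite -(geq_leqif (mxrank_leqif_sup xX)) rank_rV nz_x.
  case/sub_rVP => l ul; have [l0|nz_l] := eqVneq l 0; first by rewrite ul l0 scale0r.
  case/eqP: nz_x; apply: (kernel_at_meets_S NAB SN nz_dc).
    exact: dnorm_nilpotent nz_dc nz_l ul.
  by move: xX; rewrite sub_capmx => /andP[/sub_kermxP].
pose v' := v - (d.@[c 0])^-1 *: (v *m Nc).
(* With this coefficient [v' - b e'] is orthogonal to [H(c)], hence in [X]. *)
pose b := (v' *m Hc^T) 0 0 / ((e *m H^T) 0 0).@[c 0].
have -> : v = (d.@[c 0])^-1 *: (v *m Nc) + (b *: e' + (v' - b *: e')).
  by rewrite addrC [b *: _ + _]addrC !subrK.
rewrite dnorm_evD dnorm_evZ uN scaler0 add0r dnorm_evD dnorm_evZ ue' scaler0 add0r; apply: uX.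
rewrite sub_capmx; apply/andP; split; apply/sub_kermxP.
  by rewrite mulmxBl -scalemxAl !proj_S scaler0 subrr.
have mx00 (y z : 'M[L]_1) k : (y - k *: z) 0 0 = y 0 0 - k * z 0 0 by rewrite !mxE.
apply/rowP => i; rewrite ord1 mulmxBl -scalemxAl mx00.
by rewrite tE /b mulfVK // subrr mxE.
Qed.

(** By [dnorm_ev_eq0] the derivative of [w N / d] vanishes wherever [d t] does not, hence
    identically. Then [w N] is [d] times a constant vector, and its value at [c] shows that this
    vector is [w]. *)
Lemma rank2_constant_kernel : exists2 c : 'rV[L]_m, (\rank (evmx c A) <= rankF A)%N &
  forall w : 'rV[L]_m, w *m evmx c A = 0 -> mxC m w *m A = 0.
Proof.
pose t := (e *m H^T) 0 0; have nz_t : t != 0 := euler_nonisotropic.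
have [c] := meval_neq0 char0 (mulf_neq0 nz_d nz_t).
rewrite mevalM mulf_eq0 negb_or => /andP[nz_dc nz_tc].
exists c => [|w wA]; first by apply: (rank_at nz_d rS NA NS).
pose P := mxC m w *m N.
have Pc : evmx c P = d.@[c 0] *: w by rewrite evmxM evmx_mxC (kernel_at NAB).
have dP i v : d * ddir (mxC m v) (P 0 i) = ddir (mxC m v) d * P 0 i.
  apply/eqP; rewrite -subr_eq0 -dnormE.
  suff /eqP : d * t * dnorm d N (mxC m v) w 0 i = 0.
    by rewrite !mulf_eq0 (negPf nz_d) (negPf nz_t).
  apply: (meval_all0 char0) => x; rewrite !mevalM.
  have [->|nz_dx] := eqVneq d.@[x 0] 0; first by rewrite !mul0r.
  have [->|nz_tx] := eqVneq t.@[x 0] 0; first by rewrite mulr0 mul0r.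
  have /rowP/(_ i) := dnorm_ev_eq0 w v nz_dx nz_tx.
  by rewrite [LHS]mxE => ->; rewrite mxE mulr0.
have PE : P = d *: mxC m w.
  apply/rowP => i; apply/eqP; rewrite -subr_eq0; apply/eqP.
  apply: (meval_all0 char0) => x; apply: (mulfI nz_dc).
  have := proportional_of_wronskian x (dP i) nz_dc; rewrite mevalB mulrBr => ->.
  have -> : (P 0 i).@[c 0] = d.@[c 0] * w 0 i.
    by have /rowP/(_ i) := Pc; rewrite [LHS]mxE => ->; rewrite mxE.
  by rewrite !mxE mevalM mevalC mulr0; ring.
have : P *m A = 0 by rewrite /P -mulmxA NA mulmx0.
by rewrite PE -scalemxAl => /(scalemx_eq0 nz_d).
Qed.

End RankTwo.

(* The second alternative says that [0] is an image apex of [grad h]. *)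
Lemma hessian_constant_kernel (L : fieldType) (char0 : [pchar L] =i pred0) (m : nat)
    (h : {mpoly L[m]}) :
  (rankF (hessian h) <= 1)%N \/ rankF (hessian h) = 2%N /\
    (forall f : {mpoly L[m]}, mcomp (fun i => h^`M(i)) f = 0 ->
       forall s (c : 'rV[L]_m), f.@[fun i => s * h^`M(i).@[c 0]] = 0) ->
  exists2 c : 'rV[L]_m, (\rank (evmx c (hessian h)) <= rankF (hessian h))%N &
    forall w : 'rV[L]_m, w *m evmx c (hessian h) = 0 -> mxC m w *m hessian h = 0.
Proof.
case=> [rk1|[rk2 cone]].
  exact: (@rank1_constant_kernel _ char0 _ _ (fun j => h^`M(j)) (@autoparallel_hessian _ _ h) rk1).
have [d [S [N [B [nz_d rS NAB NA [NS SN]]]]]] := kernel_projection (hessian h).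
have /submxP[y gy] := cone_tangent char0 cone.
have [a nz_a [e ey]] := clear_denominators y.
apply: (@rank2_constant_kernel _ char0 _ _ rk2 e a nz_a _ d S N B) => //.
by apply: map_tofrac_inj; rewrite map_mxM ey -scalemxAl -gy map_mxZ.
Qed.

(** * The closure of the image as an affine space *)

Section Plane.

Variables (L : fieldType) (char0 : [pchar L] =i pred0) (m : nat).

Lemma mcomp_eq0P (n k : nat) (F : 'I_n -> {mpoly L[k]}) (f : {mpoly L[n]}) :
  mcomp F f = 0 <-> forall v : 'I_k -> L, f.@[fun i => (F i).@[v]] = 0.
Proof.
split=> [F0 v|F0]; first by rewrite -meval_mcomp F0 meval0.
by apply: (meval_all0 char0) => c; rewrite meval_mcomp.
Qed.

Lemma meval_evar k j (v : 'I_(m + k) -> L) : (@evar L m k j).@[v] = v (rshift m j).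
Proof. exact: mevalXU. Qed.

Lemma meval_lift_x k p (v : 'I_(m + k) -> L) :
  (lift_x k p).@[v] = p.@[fun i => v (lshift k i)].
Proof. by rewrite meval_mcomp; apply: meval_eq => i; rewrite mevalXU. Qed.

Definition join_args k (c : 'I_m -> L) (e : 'I_k -> L) : 'I_(m + k) -> L :=
  fun j => match split j with inl i => c i | inr i => e i end.

Lemma join_args_l k c (e : 'I_k -> L) i : join_args c e (lshift k i) = c i.
Proof. by rewrite /join_args (unsplitK (inl i)). Qed.

Lemma join_args_r k c (e : 'I_k -> L) i : join_args c e (rshift m i) = e i.
Proof. by rewrite /join_args (unsplitK (inr i)). Qed.

Lemma image_apexP (G : 'I_m -> {mpoly L[m]}) (z : 'I_m -> L) :
  image_apex G z <-> forall f, mcomp G f = 0 ->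
    forall s c, f.@[fun i => (1 - s) * (G i).@[c] + s * z i] = 0.
Proof.
split=> apex f f0.
  move=> s c; have /mcomp_eq0P/(_ (join_args c (fun=> s))) E0 := apex f f0.
  rewrite -[RHS]E0; apply: meval_eq => i.
  rewrite mevalD !mevalM mevalB meval1 mevalC meval_evar meval_lift_x join_args_r.
  by congr (_ * _ + _); apply: meval_eq => j; rewrite join_args_l.
apply/mcomp_eq0P => v; have E0 := apex f f0 (v (rshift m ord0)) (fun i => v (lshift 1 i)).
rewrite -[RHS]E0; apply: meval_eq => i.
by rewrite mevalD !mevalM mevalB meval1 mevalC meval_evar meval_lift_x.
Qed.

Variables (h : {mpoly L[m]}) (G : 'I_m -> {mpoly L[m]}) (GE : forall i, G i = h^`M(i)).
Variables (M : 'M[L]_m) (b : 'rV[L]_m).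
Let val (c : 'I_m -> L) : 'rV[L]_m := \row_i (G i).@[c].

Lemma meval_row n (f : {mpoly L[n]}) (c : 'I_n -> L) : f.@[(\row_i c i) 0] = f.@[c].
Proof. by apply: meval_eq => i; rewrite mxE. Qed.

(** Differentiating [p(G) = 0] shows that the partial derivatives of [p] at [G] are annihilated by
    the Hessian, hence by [M]. Relations are therefore closed under derivation along [w], and all
    derivatives of [f] on the line from a value of [G] in direction [w] vanish. *)
Lemma relation_translate f (w : 'rV[L]_m) :
  (fracmx (mxC m M) <= fracmx (hessian h))%MS -> (w <= M)%MS -> mcomp G f = 0 ->
  forall c, f.@[(val c + w) 0] = 0.
Proof.
move=> MA /submxP[y wM] f0 c.
have closed p : mcomp G p = 0 -> mcomp G (ddir (mxC m w) p) = 0.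
  move=> p0; pose g := \col_i mcomp G p^`M(i).
  have Ag : hessian h *m g = 0.
    apply/colP => i; rewrite mxE [RHS]mxE.
    have := congr1 (mderiv i) p0; rewrite mderiv0 mderiv_mcomp => E0.
    by rewrite -[RHS]E0; apply: eq_bigr => j _; rewrite !mxE GE mulrC.
  have Mg : mxC m M *m g = 0.
    apply: map_tofrac_inj; rewrite map_mxM map_mx0.
    by have /submxP[z ->] := MA; rewrite -mulmxA -map_mxM Ag map_mx0 mulmx0.
  have : mxC m w *m g = 0.
    by rewrite wM /mxC map_mxM -/(mxC m M) -mulmxA Mg mulmx0.
  move/matrixP/(_ 0 0); rewrite [RHS]mxE => E0; rewrite -[RHS]E0 mxE /ddir.
  rewrite /mcomp raddf_sum; apply: eq_bigr => i _ /=.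
  by rewrite rmorphM /= !mxE comp_mpolyC.
have der0 k p : mcomp G p = 0 -> ((mline (val c) w p)^`(k)).[0] = 0.
  elim: k p => [|k IHk] p p0.
    rewrite derivn0 horner_mline scale0r addr0 meval_row.
    by rewrite -meval_mcomp p0 meval0.
  by rewrite derivSn deriv_mline IHk // closed.
have -> : (val c + w) 0 = (val c + 1 *: w) 0 by rewrite scale1r.
rewrite -horner_mline (derivn_all0 char0 (p := mline _ _ _)) => [|k]; last exact: der0.
by rewrite hornerC -horner_coef0; apply: (der0 0%N).
Qed.

Hypothesis MA : (fracmx (mxC m M) <= fracmx (hessian h))%MS.
Hypothesis Gplane : forall c, ((val c - b)%R <= M)%MS.

(** All values of [G] lie in [b + M], and the translates of a single value by [M] already fill
    [b + M]. *)
Lemma relationP f : mcomp G f = 0 <-> forall w : 'rV[L]_m, (w <= M)%MS -> f.@[(b + w) 0] = 0.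
Proof.
split=> [f0 w wM|f0].
  have -> : b + w = val (fun=> 0) + (w - (val (fun=> 0) - b)).
    by apply/rowP => i; rewrite !mxE; ring.
  by apply: relation_translate => //; rewrite addmx_sub // -scaleN1r scalemx_sub.
apply/mcomp_eq0P => c; rewrite -(meval_row f) -/(val c).
by rewrite -[val c](subrK b) addrC f0.
Qed.

(** The columns of [cokermx M] provide affine-linear equations for [b + M]. *)
Lemma affine_relation j :
  {f : {mpoly L[m]} | forall y, f.@[y] = (((\row_i y i) - b) *m cokermx M) 0 j}.
Proof.
exists (\sum_i (cokermx M) i j *: ('X_i - (b 0 i)%:MP)) => y.
rewrite raddf_sum mxE; apply: eq_bigr => i _ /=.
by rewrite mevalZ mevalB mevalXU mevalC !mxE mulrC.
Qed.

Lemma in_plane (z : 'I_m -> L) :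
  (forall f, mcomp G f = 0 -> f.@[z] = 0) -> (((\row_i z i) - b)%R <= M)%MS.
Proof.
move=> zP; rewrite submxE; apply/eqP/rowP => j; rewrite [RHS]mxE.
have [f fE] := affine_relation j; rewrite -fE; apply: zP; apply/relationP => w.
rewrite submxE => /eqP wM; rewrite -(meval_row f) fE.
have -> : \row_i (\row_i0 (b + w) 0 i0) 0 i = b + w by apply/rowP => i; rewrite !mxE.
by rewrite addrC addKr wM mxE.
Qed.

Lemma zariski_planeP z :
  in_zariski_closure_image G z <-> (((\row_i z i) - b)%R <= M)%MS.
Proof.
split=> [zP|zM f f0].
  by apply: in_plane => f f0; apply: zP; apply/mcomp_eq0P.
rewrite -(meval_row f) -[\row_i z i](subrK b) addrC.
by apply: (proj1 (relationP f)) zM; apply/mcomp_eq0P.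
Qed.

(** Parameter value 1 shows that an apex satisfies all relations, so it lies in the plane;
    conversely an affine space contains the lines joining its points. *)
Lemma apex_planeP z : image_apex G z <-> (((\row_i z i) - b)%R <= M)%MS.
Proof.
split=> [/image_apexP zP|zM].
  apply: in_plane => f f0; rewrite -[RHS](zP f f0 1 (fun=> 0)); apply: meval_eq => i.
  by rewrite subrr mul0r add0r mul1r.
apply/image_apexP => f /relationP f0 s c.
rewrite -(meval_row f).
have -> : \row_i ((1 - s) * (G i).@[c] + s * z i) =
   b + ((1 - s) *: (val c - b) + s *: (\row_i z i - b)).
  by apply/rowP => i; rewrite !mxE; ring.
by apply: f0; rewrite addmx_sub ?scalemx_sub.
Qed.

End Plane.

Lemma grad_plane_invariant (L : fieldType) (char0 : [pchar L] =i pred0) (m : nat)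
    (h : {mpoly L[m]}) (M : 'M[L]_m) :
  (forall c : 'rV[L]_m, (evmx c (grad h) <= M)%MS) ->
  forall c w : 'rV[L]_m, M *m w^T = 0 -> h.@[(c + w) 0] = h.@[c 0].
Proof.
move=> hM c w Mw; have Dw : ddir (mxC m w) h = 0.
  apply: (meval_all0 char0) => x; have /submxP[y] := hM x.
  move/(congr1 (fun v : 'rV_m => (v *m w^T) 0 0)); rewrite -mulmxA Mw mulmx0 [RHS]mxE => E0.
  rewrite -[RHS]E0 raddf_sum mxE; apply: eq_bigr => i _ /=.
  by rewrite mevalM !mxE mevalC mulrC.
have := @mline_const _ char0 _ c (mxC m w) h _ 1; rewrite evmx_mxC scale1r.
apply=> k; rewrite (@tdir_eq0 _ _ _ 1 _ _ _ Dw) ?meval0 // => [q|i]; first by rewrite mul1r.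
by rewrite -[1 in RHS]mpolyC1 ddirC mul0r mxE ddirC mulr0.
Qed.

(** * The constant row space of a Hessian with constant kernel *)

Section ConstantPlane.

Variables (L : fieldType) (char0 : [pchar L] =i pred0) (m : nat) (h : {mpoly L[m]}).
Variable c0 : 'rV[L]_m.
Let A := hessian h.
Let M := evmx c0 A.
Hypothesis kerM : forall w : 'rV[L]_m, w *m M = 0 -> mxC m w *m A = 0.

Lemma plane_sym : M^T = M.
Proof. by rewrite map_trmx trmx_hessian. Qed.

Lemma rank_plane : (rankF A <= \rank M)%N.
Proof.
have := rank_constant_kernel (mxC_kermx_eq0 kerM).
by rewrite mxrank_ker; have := rank_leq_row M; lia.
Qed.

(** Both row spaces lie in the orthogonal complement of the constant kernel, whose dimension is the
    rank of [M]; by [rank_plane] the Hessian fills it. *)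
Lemma plane_hessian : (\rank M <= rankF A)%N -> (fracmx (mxC m M) <= fracmx A)%MS.
Proof.
move=> leM; have WA := mxC_kermx_eq0 kerM; pose W := fracmx (mxC m (kermx M))^T.
have subA : (fracmx A <= kermx W)%MS.
  apply/sub_kermxP; rewrite -map_mxM -[A]trmx_hessian -trmx_mul WA.
  by rewrite trmx0 map_mx0.
have subM : (fracmx (mxC m M) <= kermx W)%MS.
  apply/sub_kermxP; rewrite -map_mxM -{1}plane_sym /mxC -map_trmx -trmx_mul -map_mxM.
  by rewrite mulmx_ker map_mx0 trmx0 map_mx0.
apply: submx_trans subM _.
rewrite -(geq_leqif (mxrank_leqif_sup subA)) mxrank_ker /W -map_trmx mxrank_tr.
rewrite tofrac_mxC mxrank_map mxrank_ker; have := rank_leq_row M.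
by have := rank_plane; lia.
Qed.

(** For [w] in the kernel, [w . grad h] has zero derivatives and is constant. Differences of
    gradients are thus orthogonal to the kernel of the symmetric matrix [M]. *)
Lemma grad_in_plane (x c : 'rV[L]_m) : (evmx x (grad h) - evmx c (grad h) <= M)%MS.
Proof.
rewrite submxE; apply/eqP/rowP => j; rewrite [RHS]mxE; pose w := row j (cokermx M)^T.
have wM : w *m M = 0.
  by rewrite /w -row_mul -[X in _ *m X]plane_sym -trmx_mul mulmx_coker trmx0 row0.
have D0 i : (ddir (mxC m w) h)^`M(i) = 0.
  have /rowP/(_ i) := kerM wM; rewrite [RHS]mxE => E0; rewrite -[RHS]E0 mul_jac.
  rewrite /ddir raddf_sum; apply: eq_bigr => k _ /=.
  by rewrite mderivM [mxC _ _ _ _]mxE mderivC mul0r add0r mderiv_comm.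
have valE (y : 'rV[L]_m) : (ddir (mxC m w) h).@[y 0] = (evmx y (grad h) *m cokermx M) 0 j.
  rewrite raddf_sum mxE; apply: eq_bigr => i _ /=.
  by rewrite mevalM !mxE mevalC mulrC.
have subE (u v : 'rV[L]_m) : (u - v) 0 j = u 0 j - v 0 j by rewrite !mxE.
rewrite mulmxBl subE -!valE (mderiv_all0 char0 D0).
by rewrite !mevalC subrr.
Qed.

End ConstantPlane.

(** * Gcd domains, Bezout domains and integrality *)

Local Notation dvd := (@Defs.dvd _).

Section GcdDomain.

Variable R : idomainType.

(** The gcd is encoded by its set of divisors; for the empty list this forces [d = 0]. *)
Definition seq_gcd (s : seq R) (d : R) := forall c, dvd c d <-> (forall x, x \in s -> dvd c x).

Lemma dvd_refl (a : R) : dvd a a.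
Proof. by exists 1; rewrite mul1r. Qed.

Lemma dvd_trans (a b c : R) : dvd a b -> dvd b c -> dvd a c.
Proof. by case=> x -> [y ->]; exists (y * x); rewrite mulrA. Qed.

Lemma dvd_mull (a b c : R) : dvd a b -> dvd a (c * b).
Proof. by case=> x ->; exists (c * x); rewrite mulrA. Qed.

Lemma dvd_mul2l (c a b : R) : c != 0 -> dvd (c * a) (c * b) -> dvd a b.
Proof. by move=> nz_c [x E]; exists x; apply: (mulfI nz_c); rewrite E mulrCA. Qed.

Lemma dvd_mul (a b c d : R) : dvd a b -> dvd c d -> dvd (a * c) (b * d).
Proof. by case=> x -> [y ->]; exists (x * y); ring. Qed.

Hypothesis gcdR : gcd_domain R.

(** A gcd of [c a] and [c b] is a multiple [y c] of [c]; cancelling [c] shows that [y] divides [a]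
    and [b], hence [d]. *)
Lemma gcd_scale (a b d c : R) : (forall x, dvd x d <-> dvd x a /\ dvd x b) ->
  forall x, dvd x (c * a) -> dvd x (c * b) -> dvd x (c * d).
Proof.
move=> dP x xa xb; have [->|nz_c] := eqVneq c 0; first by exists 0; rewrite !mul0r.
have [g [ga gb gP]] := gcdR (c * a) (c * b).
apply: dvd_trans (gP _ xa xb) _.
have [da db] := (proj1 (dP d)) (dvd_refl d).
have [y gE] : dvd c g by apply: gP; rewrite mulrC; apply: dvd_mull; apply: dvd_refl.
rewrite gE mulrC; apply: dvd_mul (dvd_refl c) _; apply/dP.
by split; apply: (dvd_mul2l nz_c); rewrite [c * y]mulrC -gE.
Qed.

Lemma seq_gcd_exists (s : seq R) : exists d, seq_gcd s d.
Proof.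
elim: s => [|a s [d dP]]; first by exists 0 => c; split=> // _; exists 0; rewrite mul0r.
have [g [ga gd gP]] := gcdR a d; exists g => c; split=> [cg x|cs].
  rewrite inE => /orP[/eqP->|]; first exact: dvd_trans cg ga.
  by move: x; apply/dP; apply: dvd_trans cg gd.
apply: gP; first by apply: cs; rewrite mem_head.
by apply/dP => x xs; apply: cs; rewrite inE xs orbT.
Qed.

Lemma seq_gcd_cons a (s : seq R) d d' : seq_gcd (a :: s) d -> seq_gcd s d' ->
  forall x, dvd x d <-> dvd x a /\ dvd x d'.
Proof.
move=> dP d'P y; split=> [/dP ys|[ya yd']].
  split; first by apply: ys; rewrite mem_head.
  by apply/d'P => b bs; apply: ys; rewrite inE bs orbT.
apply/dP => b; rewrite inE => /orP[/eqP->//|]; by move: b; apply/d'P.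
Qed.

Lemma seq_gcd_scale (s : seq R) (d c : R) : seq_gcd s d ->
  forall x, (forall a, a \in s -> dvd x (c * a)) -> dvd x (c * d).
Proof.
elim: s d => [|a s IHs] d dP x xs.
  have [y ->] : dvd 0 d by apply/dP.
  by exists 0; rewrite mulr0 mulr0 mul0r.
have [d' d'P] := seq_gcd_exists s.
apply: (@gcd_scale a d').
- exact: seq_gcd_cons.
- by apply: xs; rewrite mem_head.
- by apply: (IHs _ d'P) => b bs; apply: xs; rewrite inE bs orbT.
Qed.

Lemma coprime_exp (a b : R) k : (forall x, dvd x a -> dvd x b -> dvd x 1) ->
  forall x, dvd x (a ^+ k) -> dvd x b -> dvd x 1.
Proof.
move=> ab; elim: k => [|k IHk] x; first by rewrite expr0.
rewrite exprS => xak xb; apply: (IHk x _ xb).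
have cop : forall y, dvd y 1 <-> dvd y a /\ dvd y b.
  by move=> y; split=> [y1|[]]; [split; rewrite -[X in dvd _ X]mulr1; apply: dvd_mull | apply: ab].
rewrite -[_ ^+ k]mulr1; apply: (gcd_scale (c := a ^+ k) cop); first by rewrite mulrC.
by apply: dvd_mull.
Qed.

(** Divide [a] and [b] by [d]: the cofactors are coprime, so are their powers, and scaling by
    [d ^+ k] gives the claim. *)
Lemma gcd_exp (a b d : R) k : (forall x, dvd x d <-> dvd x a /\ dvd x b) ->
  forall x, dvd x (a ^+ k) -> dvd x (b ^+ k) -> dvd x (d ^+ k).
Proof.
move=> dP x xa xb; have [[a1 aE] [b1 bE]] := (proj1 (dP d)) (dvd_refl d).
have [d0|nz_d] := eqVneq d 0; first by move: xa; rewrite aE d0 mulr0.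
have cop y : dvd y a1 -> dvd y b1 -> dvd y 1.
  move=> ya yb; apply: (dvd_mul2l nz_d); rewrite mulr1; apply/dP.
  by rewrite aE bE; split; rewrite mulrC; apply: dvd_mul => //; apply: dvd_refl.
have copk y : dvd y 1 <-> dvd y (a1 ^+ k) /\ dvd y (b1 ^+ k).
  split=> [y1|[ya yb]].
    by split; rewrite -[X in dvd _ X]mulr1; apply: dvd_mull.
  apply: (coprime_exp (a := a1) (b := b1 ^+ k) (k := k)) => // z za zb.
  by apply: (coprime_exp (a := b1) (b := a1) (k := k)) => // t ta tb; apply: cop.
rewrite -[_ ^+ k]mulr1; apply: (gcd_scale copk).
  by rewrite -exprMn mulrC -aE.
by rewrite -exprMn mulrC -bE.
Qed.

(** The exponent is positive because the empty list has gcd [0], whose zeroth power is [1]. *)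
Lemma seq_gcd_exp (s : seq R) d k x : seq_gcd s d ->
  (forall a, a \in s -> dvd x (a ^+ k.+1)) -> dvd x (d ^+ k.+1).
Proof.
elim: s d x => [|a s IHs] d x dP xs.
  have [y ->] : dvd 0 d by apply/dP.
  by rewrite mulr0 expr0n; exists 0; rewrite mul0r.
have [d' d'P] := seq_gcd_exists s.
apply: (@gcd_exp a d').
- exact: seq_gcd_cons.
- by apply: xs; rewrite mem_head.
- by apply: (IHs _ _ d'P) => b bs; apply: xs; rewrite inE bs orbT.
Qed.

(** Gauss-type argument: write [g = a / b]. Then [b] divides [a x ^+ k] for every entry [x], and the
    powers [x ^+ k] have gcd 1, so [b] divides [a]. *)
Lemma integral_of_primitive (s : seq R) (k : nat) (g : {fraction R}) : seq_gcd s 1 ->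
  (forall a, a \in s -> exists y, tofrac y = g * tofrac a ^+ k) -> exists y, tofrac y = g.
Proof.
move=> s1; have s_k c : (forall a, a \in s -> dvd c (a ^+ k)) -> dvd c 1.
  case: k => [|k] cs; last by rewrite -(expr1n _ k.+1); apply: seq_gcd_exp cs.
  (* For exponent 0 an entry is required; over the empty list [0] would divide [1]. *)
  case: s s1 cs => [|a s] s1 cs; last by have := cs a (mem_head _ _); rewrite expr0.
  have /s1[y /esym/eqP] : forall x, x \in [::] -> dvd (0 : R) x by [].
  by rewrite mulr0 eq_sym oner_eq0.
have [b nz_b [a gE]] := fraction_numden g => gs.
have s_k1 : seq_gcd [seq x ^+ k | x <- s] 1.
  move=> c; split=> [c1 x _|cs]; first by rewrite -[x]mulr1; apply: dvd_mull.
  by apply: s_k => x xs; apply: cs; apply: map_f.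
have [y ya] : dvd b (a * 1).
  apply: (seq_gcd_scale s_k1) => _ /mapP[x xs ->].
  have [y yE] := gs x xs; exists y; apply/eqP; rewrite -tofrac_eq; apply/eqP.
  by rewrite !rmorphM /= rmorphXn /= gE yE; ring.
exists y; apply: (@mulfI _ (tofrac b)); first by rewrite tofrac_eq0.
by rewrite -gE -[a]mulr1 ya rmorphM mulrC.
Qed.

End GcdDomain.

Lemma primitive_multiple (R : idomainType) (m : nat) (u : 'I_m -> {fraction R}) :
  (exists i, u i != 0) -> gcd_domain R ->
  exists (l : {fraction R}) (p : 'I_m -> R),
    [/\ l != 0, forall i, tofrac (p i) = l * u i & seq_gcd (codom p) 1].
Proof.
case=> i0 nz_u gcdR; have [b nz_b [a aE]] := fractions_common_den u.
have [d dP] := seq_gcd_exists gcdR (codom a).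
have /fin_all_exists[p pE] i : exists c, a i = c * d.
  by apply: (proj1 (dP d)); [apply: dvd_refl | apply: codom_f].
have nz_d : d != 0.
  apply: contra_neq nz_u => d0; apply: (@mulfI _ (tofrac b)); first by rewrite tofrac_eq0.
  by rewrite -aE pE d0 mulr0 rmorph0 mulr0.
have nz_td : tofrac d != 0 by rewrite tofrac_eq0.
exists (tofrac b / tofrac d), p; split=> [|i|c].
- by rewrite mulf_neq0 ?invr_eq0 ?tofrac_eq0.
- by rewrite mulrAC -aE pE rmorphM mulfK.
split=> [c1 x _|cp]; first by rewrite -[x]mulr1; apply: dvd_mull.
apply: (dvd_mul2l nz_d); rewrite mulr1; apply/dP => _ /codomP[i ->].
by rewrite pE mulrC; apply: dvd_mul (dvd_refl d); apply: cp; apply: codom_f.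
Qed.

(** [d] generates the ideal of the cleared numerators [a]; a relation expressing [d] through [a],
    divided by [d], yields the dual vector [ps]. *)
Lemma bezout_vector (R : idomainType) (m : nat) (u : 'I_m -> {fraction R}) :
  (exists i, u i != 0) -> bezout_domain R ->
  exists (l : {fraction R}) (p ps : 'I_m -> R),
    [/\ l != 0, forall i, tofrac (p i) = l * u i & \sum_i p i * ps i = 1].
Proof.
case=> i0 nz_u bezR; have [b nz_b [a aE]] := fractions_common_den u.
have [d dP] := bezR m a.
have /fin_all_exists[p pE] i : exists c, a i = c * d.
  apply/dP; exists (fun j => (j == i)%:R); rewrite (bigD1 i) //= eqxx mul1r.
  by rewrite big1 ?addr0 // => j /negPf->; rewrite mul0r.
have nz_d : d != 0.
  apply: contra_neq nz_u => d0; apply: (@mulfI _ (tofrac b)); first by rewrite tofrac_eq0.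
  by rewrite -aE pE d0 mulr0 rmorph0 mulr0.
have nz_td : tofrac d != 0 by rewrite tofrac_eq0.
have /dP[ps psE] : dvd d d by apply: dvd_refl.
exists (tofrac b / tofrac d), p, ps; split=> [|i|].
- by rewrite mulf_neq0 ?invr_eq0 ?tofrac_eq0.
- by rewrite mulrAC -aE pE rmorphM mulfK.
apply: (mulIf nz_d); rewrite mul1r [RHS]psE mulr_suml; apply: eq_bigr => i _.
by rewrite pE mulrA [ps i * _]mulrC.
Qed.

(** * Integral potentials over a domain embedded in a field *)

Section Scalars.

Variables (R : idomainType) (L : fieldType) (tau : {rmorphism R -> L}).
Hypotheses (tau_inj : injective tau) (char0 : [pchar L] =i pred0).

(** Values of polynomials over [R] at points with coordinates in [L]; by [eq_evm] they decide
    identities over [R]. *)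
Definition evm (k : nat) (v : 'I_k -> L) : {mpoly R[k]} -> L := meval v \o map_mpoly tau.

HB.instance Definition _ k (v : 'I_k -> L) := GRing.RMorphism.on (evm v).

Lemma evmE k (v : 'I_k -> L) p : evm v p = (map_mpoly tau p).@[v].
Proof. by []. Qed.

Lemma evmC k (v : 'I_k -> L) a : evm v a%:MP = tau a.
Proof. by rewrite evmE map_mpolyC mevalC. Qed.

Lemma evmX k (v : 'I_k -> L) i : evm v 'X_i = v i.
Proof. by rewrite evmE map_mpolyX mevalXU. Qed.

Lemma evmD k (v : 'I_k -> L) p q : evm v (p + q) = evm v p + evm v q.
Proof. exact: rmorphD. Qed.

Lemma evmZ k (v : 'I_k -> L) a p : evm v (a *: p) = tau a * evm v p.
Proof. by rewrite -mul_mpolyC rmorphM /= evmC. Qed.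

Lemma evm_tau k (v : 'I_k -> R) p : evm (fun i => tau (v i)) p = tau p.@[v].
Proof.
elim/mpoly_ring_ind: p => [c|i|p q IHp IHq|p q IHp IHq].
- by rewrite evmC mevalC.
- by rewrite evmX mevalXU.
- by rewrite rmorphD mevalD rmorphD /= -IHp -IHq.
- by rewrite rmorphM mevalM rmorphM /= -IHp -IHq.
Qed.

Lemma evm_mcomp k n (v : 'I_k -> L) (F : 'I_n -> {mpoly R[k]}) f :
  evm v (mcomp F f) = evm (fun i => evm v (F i)) f.
Proof.
elim/mpoly_ring_ind: f => [c|i|p q IHp IHq|p q IHp IHq].
- by rewrite /mcomp comp_mpolyC !evmC.
- by rewrite /mcomp comp_mpolyXU evmX -tnth_nth tnth_mktuple.
- by rewrite /mcomp comp_mpolyD !rmorphD /= -IHp -IHq.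
- by rewrite /mcomp !rmorphM /= -IHp -IHq.
Qed.

Lemma eq_evm k (p q : {mpoly R[k]}) : (forall v : 'rV[L]_k, evm (v 0) p = evm (v 0) q) -> p = q.
Proof.
move=> pq; apply/eqP; rewrite -subr_eq0; apply/eqP/mpolyP => u; apply: tau_inj.
rewrite mcoeff0 rmorph0 -(mcoeff_map_mpoly tau).
rewrite (_ : map_mpoly tau (p - q) = 0) ?mcoeff0 //; apply: (meval_all0 char0) => v.
by have /eqP := pq v; rewrite -subr_eq0 -rmorphB => /eqP.
Qed.

Lemma evm_linform k (v : 'I_k -> L) c : evm v (linform c) = \sum_i tau (c i) * v i.
Proof.
by rewrite /linform rmorph_sum; apply: eq_bigr => i _ /=; rewrite evmZ evmX.
Qed.

Lemma mderiv_linform k (c : 'I_k -> R) i : (linform c)^`M(i) = (c i)%:MP.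
Proof.
rewrite /linform raddf_sum (bigD1 i) //= big1 => [|j ne_ji].
  rewrite mderivZ mderivX mnm1E eqxx scale1r -{1}[U_(i)%MM]add0m addmK mpolyX0 addr0.
  by rewrite -mul_mpolyC mulr1.
by rewrite mderivZ mderivX mnm1E (negPf ne_ji) scale0r scaler0.
Qed.

Lemma map_mpoly_mderiv k (p : {mpoly R[k]}) i :
  map_mpoly tau p^`M(i) = (map_mpoly tau p)^`M(i).
Proof.
by apply/mpolyP => u; rewrite mcoeff_mderiv !mcoeff_map_mpoly mcoeff_mderiv raddfMn.
Qed.

Lemma map_mline k (c w : 'rV[R]_k) (p : {mpoly R[k]}) :
  map_poly tau (mline c w p) = mline (map_mx tau c) (map_mx tau w) (map_mpoly tau p).
Proof.
elim/mpoly_ring_ind: p => [a|i|p q IHp IHq|p q IHp IHq].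
- by rewrite /mline mmapC map_polyC map_mpolyC mmapC.
- rewrite /mline mmapX mmap1U map_mpolyX mmapX mmap1U.
  by rewrite rmorphD rmorphM /= !map_polyC map_polyX !mxE.
- by move: IHp IHq; rewrite /mline !rmorphD /= => -> ->.
- by move: IHp IHq; rewrite /mline !rmorphM /= => -> ->.
Qed.

Variable m : nat.

Definition tau_row (b : 'I_m -> R) : 'rV[L]_m := \row_i tau (b i).

Variables (h : {mpoly R[m]}) (G : 'I_m -> {mpoly L[m]}).
Hypothesis GE : forall i, G i = (map_mpoly tau h)^`M(i).

Section Base.

Variable b : 'I_m -> R.
(** Subtracting the linear form moves [b] to the origin of the space of gradients and keeps the
    Hessian. *)
Let h1 := h - linform b.

Lemma potential_mderiv i :
  (map_mpoly tau h1)^`M(i) = (map_mpoly tau h)^`M(i) - (tau (b i))%:MP.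
Proof.
rewrite -(map_mpoly_mderiv h1 i) -(map_mpoly_mderiv h i) /h1 mderivB mderiv_linform.
by rewrite rmorphB /= map_mpolyC.
Qed.

Lemma hessian_potential : hessian (map_mpoly tau h1) = hessian (map_mpoly tau h).
Proof.
apply/matrixP => i j; rewrite [LHS]mxE [RHS]mxE (potential_mderiv j).
by rewrite mderivB mderivC subr0.
Qed.

(** Translation by [b]: the apex condition at parameter [1 - s] is the cone condition at scale
    [s]. *)
Lemma cone_of_apex : image_apex G (fun i => tau (b i)) ->
  forall f, mcomp (fun i => (map_mpoly tau h1)^`M(i)) f = 0 ->
  forall s (c : 'rV[L]_m), f.@[fun i => s * (map_mpoly tau h1)^`M(i).@[c 0]] = 0.
Proof.
move/(image_apexP char0) => apex f f0 s c.
pose f' := mcomp (fun i => 'X_i - (tau (b i))%:MP) f.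
have f'E v : f'.@[v] = f.@[fun i => v i - tau (b i)].
  by rewrite meval_mcomp; apply: meval_eq => i; rewrite mevalB mevalXU mevalC.
have f'0 : mcomp G f' = 0.
  apply/(mcomp_eq0P char0) => v; rewrite f'E.
  have /(mcomp_eq0P char0)/(_ v) E0 := f0; rewrite -[RHS]E0.
  by apply: meval_eq => i; rewrite potential_mderiv mevalB mevalC GE.
have E0 := apex _ f'0 (1 - s) (c 0); rewrite -[RHS]E0 f'E; apply: meval_eq => i.
by rewrite potential_mderiv mevalB mevalC GE; ring.
Qed.

Variable M : 'M[L]_m.
Hypothesis MA : (fracmx (mxC m M) <= fracmx (hessian (map_mpoly tau h)))%MS.
Hypothesis Gplane : forall c : 'I_m -> L, (((\row_i (G i).@[c]) - tau_row b)%R <= M)%MS.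

Lemma potential_invariant (v w : 'rV[L]_m) : M *m w^T = 0 ->
  evm ((v + w) 0) h1 = evm (v 0) h1.
Proof.
apply: (grad_plane_invariant char0) => c.
have -> : evmx c (grad (map_mpoly tau h1)) = (\row_i (G i).@[c 0]) - tau_row b; last exact: Gplane.
apply/rowP => i; rewrite [LHS]mxE [grad _ _ _]mxE potential_mderiv.
by rewrite !mxE mevalB mevalC GE.
Qed.

(** Every polynomial parametrisation of [b + M] has the same relations as [G]; each equivalence of
    the theorem is an instance. *)
Lemma relation_paramP k (F : 'I_m -> {mpoly L[k]}) f :
  (forall v, (((\row_i (F i).@[v]) - tau_row b)%R <= M)%MS) ->
  (forall w : 'rV[L]_m, (w <= M)%MS -> exists v, forall i, (F i).@[v] = (tau_row b + w) 0 i) ->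
  mcomp G f = 0 <-> mcomp F f = 0.
Proof.
move=> Fin Fsur; have relP := relationP char0 GE MA Gplane.
split=> [/relP f0|F0].
  apply/(mcomp_eq0P char0) => v; have := f0 _ (Fin v).
  by rewrite addrC subrK meval_row.
apply/relP => w /Fsur[v vE]; have /(mcomp_eq0P char0)/(_ v) E0 := F0.
by rewrite -[RHS]E0; apply: meval_eq => i; rewrite vE.
Qed.


Lemma closure_setP z : in_zariski_closure_image G z <-> (((\row_i z i) - tau_row b)%R <= M)%MS.
Proof. exact: (zariski_planeP char0 GE MA Gplane). Qed.

Lemma apex_setP z : image_apex G z <-> (((\row_i z i) - tau_row b)%R <= M)%MS.
Proof. exact: (apex_planeP char0 GE MA Gplane). Qed.

Lemma plane_point (w : 'rV[L]_m) (F : 'I_m -> L) :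
  (w <= M)%MS -> (forall i, F i = tau (b i) + w 0 i) -> (((\row_i F i) - tau_row b)%R <= M)%MS.
Proof.
by move=> wM FE; suff -> : \row_i F i - tau_row b = w by []; apply/rowP => i;
   rewrite !mxE FE addrC addKr.
Qed.

Lemma value_row c i : (G i).@[c] = tau (b i) + ((\row_i (G i).@[c]) - tau_row b) 0 i.
Proof. by rewrite !mxE; ring. Qed.

Section Point.

Hypothesis M0 : M = 0.

Lemma potential_const : h = (h1.@[fun=> 0])%:MP + linform b.
Proof.
apply/eqP; rewrite -subr_eq; apply/eqP; rewrite -/h1; apply: eq_evm => v.
rewrite evmC -evm_tau -[v]add0r potential_invariant ?M0 ?mul0mx //.
by apply: meval_eq => i; rewrite mxE rmorph0.
Qed.

Lemma point_setP (z : 'I_m -> L) :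
  (((\row_i z i) - tau_row b)%R <= M)%MS <-> (forall i, z i = tau (b i)).
Proof.
rewrite M0 submx0 subr_eq0; split=> [/eqP/rowP E i|E].
  by have := E i; rewrite !mxE.
by apply/eqP/rowP => i; rewrite !mxE.
Qed.

Lemma point_relation f :
  (mcomp G f = 0 <->
   mcomp (fun i => (1 - @evar _ m 1 ord0) * lift_x 1 (G i)
                   + @evar _ m 1 ord0 * (tau (b i))%:MP) f = 0)
  /\
  (mcomp (fun i => (1 - @evar _ m 1 ord0) * lift_x 1 (G i)
                   + @evar _ m 1 ord0 * (tau (b i))%:MP) f = 0 <->
   f.@[fun i => tau (b i)] = 0).
Proof.
set F := fun i : 'I_m => _.
have FE : mcomp G f = 0 <-> mcomp F f = 0.
  apply: relation_paramP => [v|w].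
    apply/point_setP => i; rewrite /F mevalD !mevalM mevalB meval1 mevalC meval_evar meval_lift_x.
    rewrite (value_row (fun j => v (lshift 1 j))).
    have /eqP -> : \row_i (G i).@[fun j => v (lshift 1 j)] - tau_row b == 0.
      by rewrite -submx0 -M0 Gplane.
    by rewrite [(0 : 'rV_m) 0 i]mxE; ring.
  rewrite M0 submx0 => /eqP->; exists (join_args (fun=> 0) (fun=> 1)) => i.
  rewrite /F mevalD !mevalM mevalB meval1 mevalC meval_evar join_args_r.
  by rewrite subrr mul0r add0r mul1r addr0 mxE.
have GE0 : mcomp G f = 0 <-> f.@[fun i => tau (b i)] = 0.
  have relP := relationP char0 GE MA Gplane.
  have fb : f.@[(tau_row b + 0) 0] = f.@[fun i => tau (b i)] by rewrite addr0 meval_row.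
  split=> [/relP f0|f0]; first by rewrite -fb f0 ?sub0mx.
  by apply/relP => w; rewrite M0 submx0 => /eqP->; rewrite fb.
by split; rewrite -FE.
Qed.

End Point.

Section Line.

Variable p : 'I_m -> R.
Hypothesis spanP : forall w : 'rV[L]_m, (w <= M)%MS <-> exists l, w = l *: tau_row p.

Lemma line_setP (z : 'I_m -> L) :
  (((\row_i z i) - tau_row b)%R <= M)%MS <-> (exists l, forall i, z i = tau (b i) + l * tau (p i)).
Proof.
split=> [/spanP[l /rowP zl]|[l zl]].
  exists l => i; have := zl i; by rewrite !mxE => <-; ring.
by apply: (@plane_point (l *: tau_row p)) => [|i]; [apply/spanP; exists l | rewrite zl !mxE].
Qed.

Lemma line_relation f :
  (mcomp G f = 0 <->
   mcomp (fun i => @evar _ m 2 ord0 * (tau (p i))%:MP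
                   + (1 - @evar _ m 2 ord_max) * lift_x 2 (G i)
                   + @evar _ m 2 ord_max * (tau (b i))%:MP) f = 0)
  /\
  (mcomp (fun i => @evar _ m 2 ord0 * (tau (p i))%:MP
                   + (1 - @evar _ m 2 ord_max) * lift_x 2 (G i)
                   + @evar _ m 2 ord_max * (tau (b i))%:MP) f = 0 <->
   mcomp (fun i => @evar _ m 2 ord0 * (tau (p i))%:MP + (tau (b i))%:MP) f = 0).
Proof.
set F := fun i : 'I_m => _ + _ * _; set F' := fun i : 'I_m => _ + _.
have FE : mcomp G f = 0 <-> mcomp F f = 0.
  apply: relation_paramP => [v|w /spanP[l ->]].
    pose c := fun j => v (lshift 2 j).
    apply: (@plane_point (v (rshift m ord0) *: tau_row p
      + (1 - v (rshift m ord_max)) *: ((\row_i (G i).@[c]) - tau_row b))) => [|i].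
      by rewrite addmx_sub ?scalemx_sub //; apply/spanP; exists 1; rewrite scale1r.
    rewrite /F 2!mevalD !mevalM mevalB meval1 !mevalC !meval_evar meval_lift_x -/c.
    by rewrite (value_row c) ![in RHS]mxE; rewrite !mxE; ring.
  exists (join_args (fun=> 0) (fun j => if j == ord0 then l else 1)) => i.
  rewrite /F 2!mevalD !mevalM mevalB meval1 !mevalC !meval_evar !join_args_r eqxx /=.
  by rewrite !mxE; ring.
have FE' : mcomp G f = 0 <-> mcomp F' f = 0.
  apply: relation_paramP => [v|w /spanP[l ->]].
    apply/line_setP; exists (v (rshift m ord0)) => i.
    by rewrite /F' mevalD mevalM !mevalC meval_evar addrC.
  exists (join_args (fun=> 0) (fun=> l)) => i.
  by rewrite /F' mevalD mevalM !mevalC meval_evar join_args_r !mxE addrC.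
by split; rewrite -FE.
Qed.

Hypothesis integral : forall (k : nat) (g : L),
  (forall i, exists y, tau y = g * tau (p i) ^+ k) -> exists y, tau y = g.

(** [h1] is invariant under vectors orthogonal to [p], so it equals [ga] evaluated at the linear
    form of [p], with [ga] over [L]. On the [i]-th coordinate axis it has coefficients
    [ga_k p_i ^+ k], which come from [R]; [integral] then makes each [ga_k] integral. *)
Lemma line_potential i0 : p i0 != 0 ->
  exists g : {poly R}, h = (map_poly (@mpolyC m R) g).[linform p] + linform b.
Proof.
move=> nz_p; have nz_tp : tau (p i0) != 0.
  by apply: contra_neq nz_p => tp0; apply: tau_inj; rewrite rmorph0.
have [y My] : exists y : 'cV[L]_m, M = y *m tau_row p.
  apply/submxP/row_subP => i; have [l ->] := (proj1 (spanP _)) (row_sub i M).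
  exact: scalemx_sub.
pose form (v : 'rV[L]_m) := \sum_i tau (p i) * v 0 i.
have formE v : tau_row p *m v^T = (form v)%:M.
  apply/rowP => j; rewrite ord1 mxE [RHS]mxE eqxx.
  by apply: eq_bigr => i _; rewrite !mxE.
pose hL := map_mpoly tau h1; pose e i : 'rV[L]_m := delta_mx 0 i.
have form_e i : form (e i) = tau (p i).
  rewrite /form (bigD1 i) //= big1 => [|j ne_ji]; first by rewrite !mxE !eqxx mulr1 addr0.
  by rewrite !mxE (negPf ne_ji) mulr0.
have formZ k v : form (k *: v) = k * form v.
  by rewrite /form mulr_sumr; apply: eq_bigr => i _; rewrite !mxE; ring.
have formB v w k : form (v - k *: w) = form v - k * form w.
  by rewrite -formZ /form -sumrB; apply: eq_bigr => i _; rewrite !mxE; ring.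
pose ga := mline 0 ((tau (p i0))^-1 *: e i0) hL.
have hga (v : 'rV[L]_m) : hL.@[v 0] = ga.[form v].
  rewrite horner_mline add0r; pose v' := form v *: ((tau (p i0))^-1 *: e i0).
  rewrite -[v in LHS](subrK v') addrC; apply: potential_invariant.
  rewrite My -mulmxA formE /v' formB formZ form_e mulVf // mulr1 subrr.
  by rewrite raddf0 mulmx0.
have ga_int k : exists y, tau y = ga`_k.
  apply: (integral (k := k)) => i.
  exists (mline 0 (delta_mx 0 i) h1)`_k.
  rewrite -coef_map map_mline map_mx0 map_delta_mx -/hL.
  have -> : mline 0 (delta_mx 0 i) hL = \poly_(j < size ga) (ga`_j * tau (p i) ^+ j).
    apply/eqP; rewrite -subr_eq0; apply/eqP/(poly_eq0_char0 char0) => t.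
    rewrite hornerD hornerN horner_mline add0r hga horner_poly [ga.[_]]horner_coef.
    apply/eqP; rewrite subr_eq0; apply/eqP; apply: eq_bigr => j _.
    by rewrite formZ form_e exprMn; ring.
  by rewrite coef_poly; case: ltnP => // le_k; rewrite nth_default // mul0r.
have /fin_all_exists[a aE] (k : 'I_(size ga)) := ga_int k.
pose g := \sum_(k < size ga) a k *: 'X^k.
have gE : map_poly tau g = ga.
  rewrite raddf_sum -[RHS]coefK poly_def; apply: eq_bigr => k _.
  by rewrite /= map_polyZ map_polyXn aE.
exists g; apply/eqP; rewrite -subr_eq -/h1; apply/eqP/eq_evm => v.
rewrite evmE -/hL hga; have -> : evm (v 0) (map_poly (@mpolyC m R) g).[linform p] =
    (map_poly (evm (v 0)) (map_poly (@mpolyC m R) g)).[evm (v 0) (linform p)].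
  by rewrite horner_map.
rewrite evm_linform -/(form v) -gE -map_poly_comp; congr _.[_].
by apply: eq_map_poly => c; rewrite /= evmC.
Qed.

End Line.

Section TwoPlane.

Variables p q : 'I_m -> R.
Hypothesis spanP : forall w : 'rV[L]_m,
  (w <= M)%MS <-> exists l k, w = l *: tau_row p + k *: tau_row q.

Lemma two_plane_setP (z : 'I_m -> L) : (((\row_i z i) - tau_row b)%R <= M)%MS <->
  (exists l k, forall i, z i = tau (b i) + l * tau (p i) + k * tau (q i)).
Proof.
split=> [/spanP[l [k /rowP zl]]|[l [k zl]]].
  exists l, k => i; have := zl i; by rewrite !mxE -addrA => <-; ring.
apply: (@plane_point (l *: tau_row p + k *: tau_row q)) => [|i].
  by apply/spanP; exists l, k.
by rewrite zl !mxE addrA.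
Qed.

Lemma two_plane_relation f :
  (mcomp G f = 0 <->
   mcomp (fun i => @evar _ m 3 ord0 * (tau (p i))%:MP
                   + @evar _ m 3 (inord 1) * (tau (q i))%:MP
                   + (1 - @evar _ m 3 (inord 2)) * lift_x 3 (G i)
                   + @evar _ m 3 (inord 2) * (tau (b i))%:MP) f = 0)
  /\
  (mcomp (fun i => @evar _ m 3 ord0 * (tau (p i))%:MP
                   + @evar _ m 3 (inord 1) * (tau (q i))%:MP
                   + (1 - @evar _ m 3 (inord 2)) * lift_x 3 (G i)
                   + @evar _ m 3 (inord 2) * (tau (b i))%:MP) f = 0 <->
   mcomp (fun i => @evar _ m 3 ord0 * (tau (p i))%:MP
                   + @evar _ m 3 (inord 1) * (tau (q i))%:MP
                   + (tau (b i))%:MP) f = 0).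
Proof.
set F := fun i : 'I_m => _ + _ * _; set F' := fun i : 'I_m => _ + _.
have E1 : (inord 1 == ord0 :> 'I_3) = false by rewrite -val_eqE /= inordK.
have E2 : (inord 2 == ord0 :> 'I_3) = false by rewrite -val_eqE /= inordK.
have E3 : (inord 2 == inord 1 :> 'I_3) = false by rewrite -val_eqE /= !inordK.
pose e l k : 'I_3 -> L := fun j => if j == ord0 then l else if j == inord 1 then k else 1.
have FE : mcomp G f = 0 <-> mcomp F f = 0.
  apply: relation_paramP => [v|w /spanP[l [k ->]]].
    pose c := fun j => v (lshift 3 j).
    apply: (@plane_point (v (rshift m ord0) *: tau_row p + v (rshift m (inord 1)) *: tau_row q
      + (1 - v (rshift m (inord 2))) *: ((\row_i (G i).@[c]) - tau_row b))) => [|i].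
      by rewrite addmx_sub ?scalemx_sub //; apply/spanP; eexists; eexists.
    rewrite /F 3!mevalD !mevalM mevalB meval1 !mevalC !meval_evar meval_lift_x -/c.
    by rewrite (value_row c) !mxE; ring.
  exists (join_args (fun=> 0) (e l k)) => i.
  rewrite /F 3!mevalD !mevalM mevalB meval1 !mevalC !meval_evar !join_args_r.
  by rewrite /e !eqxx E1 E2 E3 !mxE; ring.
have FE' : mcomp G f = 0 <-> mcomp F' f = 0.
  apply: relation_paramP => [v|w /spanP[l [k ->]]].
    apply/two_plane_setP; exists (v (rshift m ord0)), (v (rshift m (inord 1))) => i.
    by rewrite /F' 2!mevalD !mevalM !mevalC !meval_evar; ring.
  exists (join_args (fun=> 0) (e l k)) => i.
  rewrite /F' 2!mevalD !mevalM !mevalC !meval_evar !join_args_r.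
  by rewrite /e !eqxx E1 !mxE; ring.
by split; rewrite -FE.
Qed.

(* [x] and [(p.x) ps + (q.x) qs] only differ by a vector orthogonal to the plane. *)
Lemma two_plane_potential (ps qs : 'I_m -> R) :
  M = M *m (tau_row ps)^T *m tau_row p + M *m (tau_row qs)^T *m tau_row q ->
  exists g : {mpoly R[2]},
    h = mcomp (fun j : 'I_2 => if j == ord0 then linform p else linform q) g + linform b.
Proof.
move=> ME.
exists (mcomp (fun i => ps i *: 'X_ord0 + qs i *: 'X_ord_max) h1).
apply/eqP; rewrite -subr_eq -/h1; apply/eqP/eq_evm => v.
rewrite 2!evm_mcomp.
pose form c := \sum_i tau (c i) * v 0 i.
pose v' : 'rV[L]_m := form p *: tau_row ps + form q *: tau_row qs.
have formE c : tau_row c *m v^T = (form c)%:M.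
  apply/rowP => j; rewrite ord1 mxE [RHS]mxE eqxx.
  by apply: eq_bigr => i _; rewrite !mxE.
rewrite -[v in LHS](subrK v') [_ + v']addrC potential_invariant.
  apply: meval_eq => i.
  by rewrite evmD !evmZ !evmX /= !evm_linform -/(form p) -/(form q) !mxE; ring.
rewrite linearB mulmxBr {1}ME mulmxDl -!mulmxA !formE /v' linearD !linearZ /=.
by rewrite mulmxDr -!scalemxAr !mul_mx_scalar -!scalemxAr subrr.
Qed.

End TwoPlane.

End Base.

(** * The cases of rank at most zero, one and two *)

Local Notation A := (hessian (map_mpoly tau h)).

(** The base point is the gradient at the origin, which has coordinates in [R]. *)
Lemma base_plane : (rankF A <= 1)%N ->
  exists (M : 'M[L]_m) (b : 'I_m -> R), [/\ \rank M = rankF A,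
    (fracmx (mxC m M) <= fracmx A)%MS &
    forall c : 'I_m -> L, (((\row_i (G i).@[c]) - tau_row b)%R <= M)%MS].
Proof.
move=> le1; have [c0 lec0 kerM] := hessian_constant_kernel char0 (or_introl le1).
exists (evmx c0 A), (fun i => h^`M(i).@[fun=> 0]); split.
- by apply/eqP; rewrite eqn_leq lec0 rank_plane.
- exact: plane_hessian.
move=> c; have := grad_in_plane char0 kerM (\row_i c i) 0.
congr (submx _ _); congr (_ - _); apply/rowP => i; rewrite !mxE.
  by rewrite GE meval_row.
rewrite -map_mpoly_mderiv -evm_tau -evmE; apply: meval_eq => j.
by rewrite mxE rmorph0.
Qed.

(** The kernel is constant by the criterion applied to [h - linform b]. The image then lies in a
    translate of [M] through the gradient at the origin; the apex lies there too, so it can serve as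
    base point. *)
Lemma apex_plane (b : 'I_m -> R) : image_apex G (fun i => tau (b i)) -> (rankF A <= 2)%N ->
  exists M : 'M[L]_m, [/\ \rank M = rankF A,
    (fracmx (mxC m M) <= fracmx A)%MS &
    forall c : 'I_m -> L, (((\row_i (G i).@[c]) - tau_row b)%R <= M)%MS].
Proof.
move=> apex le2; have hypA : (rankF A <= 1)%N \/ rankF A = 2%N by lia.
have [c0 lec0 kerM] : exists2 c : 'rV[L]_m, (\rank (evmx c A) <= rankF A)%N &
    forall w : 'rV[L]_m, w *m evmx c A = 0 -> mxC m w *m A = 0.
  rewrite -(hessian_potential b) in hypA *; apply: (hessian_constant_kernel char0).
  by case: hypA => [|rk2]; [left | right; split=> //; apply: cone_of_apex].
have MA := plane_hessian kerM lec0.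
have plane0 (c : 'I_m -> L) :
    (((\row_i (G i).@[c]) - (\row_i (G i).@[fun=> 0]))%R <= evmx c0 A)%MS.
  have := grad_in_plane char0 kerM (\row_i c i) 0.
  congr (submx _ _); congr (_ - _); apply/rowP => i; rewrite !mxE GE.
    by rewrite meval_row.
  by apply: meval_eq => j; rewrite mxE.
exists (evmx c0 A); split=> // [|c].
  by apply/eqP; rewrite eqn_leq lec0 rank_plane.
have := proj1 (apex_planeP char0 GE MA plane0 _) apex; rewrite -/(tau_row b) => bM.
have -> : \row_i (G i).@[c] - tau_row b = (\row_i (G i).@[c] - \row_i (G i).@[fun=> 0])
    + (-1) *: (tau_row b - \row_i (G i).@[fun=> 0]).
  by rewrite scaleN1r opprB addrA subrK.
by rewrite addmx_sub ?scalemx_sub.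
Qed.

Lemma point_case : rankF A = 0%N -> exists b : 'I_m -> R,
  [/\ image_apex G (fun i => tau (b i)),
      exists g : R, h = g%:MP + linform b,
      forall z, in_zariski_closure_image G z <-> (forall i, z i = tau (b i)),
      forall z, image_apex G z <-> (forall i, z i = tau (b i)) &
      forall f,
        (mcomp G f = 0 <->
         mcomp (fun i => (1 - @evar _ m 1 ord0) * lift_x 1 (G i)
                         + @evar _ m 1 ord0 * (tau (b i))%:MP) f = 0)
        /\
        (mcomp (fun i => (1 - @evar _ m 1 ord0) * lift_x 1 (G i)
                         + @evar _ m 1 ord0 * (tau (b i))%:MP) f = 0 <->
         f.@[fun i => tau (b i)] = 0)].
Proof.
move=> rk0; have [|M [b [rM MA Gplane]]] := base_plane; first by rewrite rk0.
have M0 : M = 0 by apply/eqP; rewrite -mxrank_eq0 rM rk0.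
have apexE z : image_apex G z <-> (forall i, z i = tau (b i)).
  exact: iff_trans (apex_setP MA Gplane z) (point_setP b M0 z).
exists b; split=> //.
- by apply/apexE.
- by eexists; apply: (potential_const Gplane M0).
- by move=> z; exact: iff_trans (closure_setP MA Gplane z) (point_setP b M0 z).
- exact: (point_relation MA Gplane M0).
Qed.

Lemma line_case : (rankF A <= 1)%N ->
  (forall u : 'rV[L]_m, u != 0 -> exists (l : L) (p : 'I_m -> R),
    [/\ l != 0, tau_row p = l *: u & forall k g,
       (forall i, exists y, tau y = g * tau (p i) ^+ k) -> exists y, tau y = g]) ->
  exists (b : 'I_m -> R) (g : {poly R}) (p : 'I_m -> R),
  [/\ image_apex G (fun i => tau (b i)),
      h = (map_poly (@mpolyC m R) g).[linform p] + linform b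
      /\ \rank (\matrix_(i < m, j < 1) tau (p i)) = rankF A,
      forall z, in_zariski_closure_image G z <->
        (exists lam, forall i, z i = tau (b i) + lam * tau (p i)),
      forall z, image_apex G z <->
        (exists lam, forall i, z i = tau (b i) + lam * tau (p i)) &
      forall f,
        (mcomp G f = 0 <->
         mcomp (fun i => @evar _ m 2 ord0 * (tau (p i))%:MP
                         + (1 - @evar _ m 2 ord_max) * lift_x 2 (G i)
                         + @evar _ m 2 ord_max * (tau (b i))%:MP) f = 0)
        /\
        (mcomp (fun i => @evar _ m 2 ord0 * (tau (p i))%:MP
                         + (1 - @evar _ m 2 ord_max) * lift_x 2 (G i)
                         + @evar _ m 2 ord_max * (tau (b i))%:MP) f = 0 <->
         mcomp (fun i => @evar _ m 2 ord0 * (tau (p i))%:MP + (tau (b i))%:MP) f = 0)].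
Proof.
move=> rk1 prim; have [M [b [rM MA Gplane]]] := base_plane rk1.
have [p [spanP [g hE]]] : exists p : 'I_m -> R,
    (forall w : 'rV[L]_m, (w <= M)%MS <-> exists l, w = l *: tau_row p) /\
    exists g : {poly R}, h = (map_poly (@mpolyC m R) g).[linform p] + linform b.
  have [M0|nz_M] := eqVneq M 0.
    exists (fun=> 0); split=> [w|].
      have -> : tau_row (fun=> 0) = 0 by apply/rowP => i; rewrite !mxE rmorph0.
      rewrite M0 submx0; split=> [/eqP->|[l ->]]; last by rewrite scaler0.
      by exists 0; rewrite scaler0.
    exists ((h - linform b).@[fun=> 0])%:P.
    by rewrite map_polyC hornerC; apply: (potential_const Gplane M0).
  (* Here [M] has rank one, so any nonzero [u] in it spans it and may be rescaled to an integral
     [p]. *)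
  have /rowV0Pn[u uM nz_u] := nz_M.
  have [l [p [nz_l pE integral]]] := prim u nz_u.
  have spanP w : (w <= M)%MS <-> exists k, w = k *: tau_row p.
    have Mu : (M <= u)%MS.
      by rewrite -(geq_leqif (mxrank_leqif_sup uM)) rank_rV nz_u rM.
    split=> [wM|[k ->]]; last by rewrite pE !scalemx_sub.
    have /sub_rVP[k ->] := submx_trans wM Mu; exists (k / l).
    by rewrite pE scalerA mulfVK.
  exists p; split=> //.
  have [i0 nz_p] : exists i, p i != 0.
    apply: NNPP => p0; case/eqP: nz_u; apply: (scalerI nz_l); rewrite scaler0 -pE.
    apply/rowP => i; rewrite !mxE; apply/eqP.
    case: (eqVneq (p i) 0) => [->|nz]; first by rewrite rmorph0.
    by case: p0; exists i.
  exact: (line_potential Gplane spanP integral nz_p).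
exists b, g, p; split=> //.
- apply/(apex_setP MA Gplane)/(line_setP b spanP); exists 0 => i.
  by rewrite mul0r addr0.
- split=> //; rewrite -rM -mxrank_tr (_ : _^T = tau_row p); last first.
    by apply/matrixP => i j; rewrite !mxE.
  apply/eqmx_rank/andP; split; first by apply/spanP; exists 1; rewrite scale1r.
  by apply/row_subP => i; have [l ->] := (proj1 (spanP _)) (row_sub i M); apply: scalemx_sub.
- by move=> z; exact: iff_trans (closure_setP MA Gplane z) (line_setP b spanP z).
- by move=> z; exact: iff_trans (apex_setP MA Gplane z) (line_setP b spanP z).
- exact: (line_relation MA Gplane spanP).
Qed.

(** A Gram-Schmidt process over [R]: take [p] in [M] with dual vector [ps], then [q] in the part
    [M1] of [M] annihilated by [ps]. The pairs are dual bases, and by rank [p] and [q] span [M]. *)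
Lemma dual_basis2 (M : 'M[L]_m) : (\rank M <= 2)%N ->
  (forall u : 'rV[L]_m, u != 0 -> exists (l : L) (p ps : 'I_m -> R),
    [/\ l != 0, tau_row p = l *: u & \sum_i p i * ps i = 1]) ->
  exists p q ps qs : 'I_m -> R, [/\ (tau_row p <= M)%MS, (tau_row q <= M)%MS &
    M = M *m (tau_row ps)^T *m tau_row p + M *m (tau_row qs)^T *m tau_row q].
Proof.
move=> le2 bez; have tau_row0 : tau_row (fun=> 0) = 0.
  by apply/rowP => i; rewrite !mxE rmorph0.
have pair x y : tau_row x *m (tau_row y)^T = (tau (\sum_i x i * y i))%:M.
  apply/rowP => j; rewrite ord1 mxE [RHS]mxE eqxx mulr1n rmorph_sum.
  by apply: eq_bigr => i _; rewrite !mxE rmorphM.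
have [M0|/rowV0Pn[u uM nz_u]] := eqVneq M 0.
  exists (fun=> 0), (fun=> 0), (fun=> 0), (fun=> 0).
  by rewrite tau_row0 sub0mx !mulmx0 addr0.
have [l [p [ps [nz_l pE pps]]]] := bez u nz_u.
have pM : (tau_row p <= M)%MS by rewrite pE scalemx_sub.
pose M1 := M - M *m (tau_row ps)^T *m tau_row p.
have [/eqP|/rowV0Pn[u1 u1M nz_u1]] := eqVneq M1 0.
  rewrite subr_eq0 => /eqP ME; exists p, (fun=> 0), ps, (fun=> 0).
  by rewrite tau_row0 sub0mx mulmx0 addr0 -ME.
have [l1 [q [qs0 [nz_l1 qE qqs0]]]] := bez u1 nz_u1.
have M1M : (M1 <= M)%MS.
  by rewrite addmx_sub // -scaleN1r scalemx_sub // mulmx_sub.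
have qM : (tau_row q <= M)%MS by rewrite qE scalemx_sub // (submx_trans u1M).
have M1ps : M1 *m (tau_row ps)^T = 0.
  by rewrite mulmxBl -[_ *m tau_row p *m _]mulmxA pair pps rmorph1 mulmx1 subrr.
have qps : tau_row q *m (tau_row ps)^T = 0.
  have /submxP[y u1E] := u1M.
  by rewrite qE u1E -scalemxAl -mulmxA M1ps mulmx0 scaler0.
(* Subtracting [s ps] makes [p . qs = 0] and keeps [q . qs = 1], because [q . ps = 0]. *)
pose s := \sum_i p i * qs0 i; pose qs i := qs0 i - s * ps i.
have qsE x : \sum_i x i * qs i = \sum_i x i * qs0 i - s * \sum_i x i * ps i.
  by rewrite mulr_sumr -sumrB; apply: eq_bigr => i _; rewrite /qs; ring.
have pqs : tau_row p *m (tau_row qs)^T = 0.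
  by rewrite pair qsE pps mulr1 subrr rmorph0 raddf0.
have qqs : tau_row q *m (tau_row qs)^T = 1%:M.
  have q_ps : tau (\sum_i q i * ps i) = 0.
    by have /matrixP/(_ 0 0) := etrans (esym (pair q ps)) qps; rewrite !mxE eqxx.
  by rewrite pair qsE qqs0 rmorphB rmorphM q_ps mulr0 subr0 rmorph1.
have {}pps : tau_row p *m (tau_row ps)^T = 1%:M by rewrite pair pps rmorph1.
exists p, q, ps, qs; split=> //.
pose E := col_mx (tau_row p) (tau_row q).
have EX : E *m row_mx (tau_row ps)^T (tau_row qs)^T = 1%:M.
  by rewrite mul_col_row pps pqs qps qqs -scalar_mx_block.
have EM : (E <= M)%MS by rewrite -addsmxE addsmx_sub pM qM.
have rE : (2 <= \rank E)%N by have := mxrankM_maxl E (row_mx (tau_row ps)^T (tau_row qs)^T);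
  rewrite EX mxrank1.
have /submxP[y My] : (M <= E)%MS.
  by rewrite -(geq_leqif (mxrank_leqif_sup EM)) (leq_trans le2).
have {}My : M = lsubmx y *m tau_row p + rsubmx y *m tau_row q.
  by rewrite My -mul_row_col hsubmxK.
have -> : M *m (tau_row ps)^T = lsubmx y.
  by rewrite My mulmxDl -!mulmxA pps qps mulmx1 mulmx0 addr0.
have -> : M *m (tau_row qs)^T = rsubmx y.
  by rewrite My mulmxDl -!mulmxA pqs qqs mulmx1 mulmx0 add0r.
exact: My.
Qed.

Lemma two_plane_case (b : 'I_m -> R) : image_apex G (fun i => tau (b i)) -> (rankF A <= 2)%N ->
  (forall u : 'rV[L]_m, u != 0 -> exists (l : L) (p ps : 'I_m -> R),
    [/\ l != 0, tau_row p = l *: u & \sum_i p i * ps i = 1]) ->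
  exists (g : {mpoly R[2]}) (p q : 'I_m -> R),
  [/\ h = mcomp (fun j : 'I_2 => if j == ord0 then linform p else linform q) g + linform b,
      \rank (\matrix_(i < m, j < 2) tau (if j == ord0 then p i else q i)) = rankF A,
      forall z, in_zariski_closure_image G z <->
        (exists lam mu, forall i, z i = tau (b i) + lam * tau (p i) + mu * tau (q i)),
      forall z, image_apex G z <->
        (exists lam mu, forall i, z i = tau (b i) + lam * tau (p i) + mu * tau (q i)) &
      forall f,
        (mcomp G f = 0 <->
         mcomp (fun i => @evar _ m 3 ord0 * (tau (p i))%:MP
                         + @evar _ m 3 (inord 1) * (tau (q i))%:MP
                         + (1 - @evar _ m 3 (inord 2)) * lift_x 3 (G i)
                         + @evar _ m 3 (inord 2) * (tau (b i))%:MP) f = 0)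
        /\
        (mcomp (fun i => @evar _ m 3 ord0 * (tau (p i))%:MP
                         + @evar _ m 3 (inord 1) * (tau (q i))%:MP
                         + (1 - @evar _ m 3 (inord 2)) * lift_x 3 (G i)
                         + @evar _ m 3 (inord 2) * (tau (b i))%:MP) f = 0 <->
         mcomp (fun i => @evar _ m 3 ord0 * (tau (p i))%:MP
                         + @evar _ m 3 (inord 1) * (tau (q i))%:MP
                         + (tau (b i))%:MP) f = 0)].
Proof.
move=> apex le2 bez; have [M [rM MA Gplane]] := apex_plane apex le2.
have [|p [q [ps [qs [pM qM ME]]]]] := @dual_basis2 M _ bez; first by rewrite rM.
have spanP w : (w <= M)%MS <-> exists l k, w = l *: tau_row p + k *: tau_row q.
  split=> [/submxP[y wM]|[l [k ->]]]; last by rewrite addmx_sub ?scalemx_sub.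
  exists ((w *m (tau_row ps)^T) 0 0), ((w *m (tau_row qs)^T) 0 0).
  rewrite -!mul_scalar_mx -!mx11_scalar {1}wM {1}ME mulmxDr !mulmxA.
  by rewrite -wM.
have [g hE] := two_plane_potential Gplane ME.
exists g, p, q; split=> //.
- rewrite -rM -mxrank_tr; set T := _^T; apply/eqmx_rank/andP; split.
    apply/row_subP => j.
    have -> : row j T = if j == ord0 then tau_row p else tau_row q.
      by apply/rowP => i; rewrite !mxE; case: ifP; rewrite !mxE.
    by case: ifP.
  have pT : (tau_row p <= T)%MS.
    by rewrite (_ : tau_row p = row ord0 T) ?row_sub //; apply/rowP => i; rewrite !mxE.
  have qT : (tau_row q <= T)%MS.
    by rewrite (_ : tau_row q = row ord_max T) ?row_sub //; apply/rowP => i; rewrite !mxE.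
  by rewrite ME addmx_sub ?mulmx_sub.
- by move=> z; exact: iff_trans (closure_setP MA Gplane z) (two_plane_setP b spanP z).
- by move=> z; exact: iff_trans (apex_setP MA Gplane z) (two_plane_setP b spanP z).
- exact: (two_plane_relation MA Gplane spanP).
Qed.

End Scalars.

(** * Specialisation to the fraction field *)

Lemma pchar_fraction (R : idomainType) : [pchar R] =i pred0 -> [pchar {fraction R}] =i pred0.
Proof.
move=> charR p; rewrite -(charR p) !inE; congr (_ && _).
by rewrite -(rmorph_nat (@FracField.tofrac R)) tofrac_eq0.
Qed.

Lemma tofrac_inj (R : idomainType) : injective (@FracField.tofrac R).
Proof. by move=> x y /eqP; rewrite tofrac_eq => /eqP. Qed.

Lemma polyLv_gradE (R : idomainType) (m : nat) (H : 'I_m -> {mpoly R[m]}) h :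
  (forall i, H i = mderiv i h) ->
  forall i, polyLv H i = (map_mpoly (@FracField.tofrac R) h)^`M(i).
Proof. by move=> HE i; rewrite -map_mpoly_mderiv -HE. Qed.

Lemma jac_rankE (R : idomainType) (m : nat) (H : 'I_m -> {mpoly R[m]}) h :
  (forall i, H i = mderiv i h) ->
  jac_rank H = rankF (hessian (map_mpoly (@FracField.tofrac R) h)).
Proof.
move=> HE; congr (\rank _); apply/matrixP => i j; rewrite [LHS]mxE [RHS]mxE.
congr (FracField.tofrac _); rewrite [jacobian H i j]mxE [hessian _ i j]mxE HE.
by rewrite mderiv_comm -(map_mpoly_mderiv (@FracField.tofrac R)) -map_mpoly_mderiv.
Qed.

Theorem theorem6p2 (R : idomainType) (m : nat)
    (H : 'I_m -> {mpoly R[m]}) (h : {mpoly R[m]}) :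
  [pchar R] =i pred0 ->
  (jacobian H)^T = jacobian H ->
  (forall i : 'I_m, H i = mderiv i h) ->
  (* (i) *)
  ((jac_rank H = 0%N ->
    exists b : 'I_m -> R,
      [/\ image_apex (polyLv H) (vecL b),
          exists g : R, h = g%:MP + linform b,
          forall z : 'I_m -> {fraction R},
            in_zariski_closure_image (polyLv H) z <-> (forall i, z i = vecL b i),
          forall z : 'I_m -> {fraction R},
            image_apex (polyLv H) z <-> (forall i, z i = vecL b i) &
          forall f : {mpoly {fraction R}[m]},
            (mcomp (polyLv H) f = 0 <->
             mcomp (fun i => (1 - @evar _ m 1 ord0) * lift_x 1 (polyLv H i)
                             + @evar _ m 1 ord0 * (vecL b i)%:MP) f = 0)
            /\
            (mcomp (fun i => (1 - @evar _ m 1 ord0) * lift_x 1 (polyLv H i)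
                             + @evar _ m 1 ord0 * (vecL b i)%:MP) f = 0 <->
             f.@[vecL b] = 0)])
  (* (ii) *)
  /\ ((jac_rank H <= 1)%N -> gcd_domain R ->
    exists (b : 'I_m -> R) (g : {poly R}) (p : 'I_m -> R),
      [/\ image_apex (polyLv H) (vecL b),
          h = (map_poly (@mpolyC m R) g).[linform p] + linform b
          /\ rank1 p = jac_rank H,
          forall z : 'I_m -> {fraction R},
            in_zariski_closure_image (polyLv H) z <->
            (exists lam : {fraction R}, forall i, z i = vecL b i + lam * vecL p i),
          forall z : 'I_m -> {fraction R},
            image_apex (polyLv H) z <->
            (exists lam : {fraction R}, forall i, z i = vecL b i + lam * vecL p i) &
          forall f : {mpoly {fraction R}[m]},
            (mcomp (polyLv H) f = 0 <->
             mcomp (fun i => @evar _ m 2 ord0 * (vecL p i)%:MP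
                             + (1 - @evar _ m 2 ord_max) * lift_x 2 (polyLv H i)
                             + @evar _ m 2 ord_max * (vecL b i)%:MP) f = 0)
            /\
            (mcomp (fun i => @evar _ m 2 ord0 * (vecL p i)%:MP
                             + (1 - @evar _ m 2 ord_max) * lift_x 2 (polyLv H i)
                             + @evar _ m 2 ord_max * (vecL b i)%:MP) f = 0 <->
             mcomp (fun i => @evar _ m 2 ord0 * (vecL p i)%:MP
                             + (vecL b i)%:MP) f = 0)])
  (* (iii) *)
  /\ (forall b : 'I_m -> R, image_apex (polyLv H) (vecL b) ->
    (jac_rank H <= 2)%N -> bezout_domain R ->
    exists (g : {mpoly R[2]}) (p q : 'I_m -> R),
      [/\ h = mcomp (fun j : 'I_2 => if j == ord0 then linform p else linform q) g
              + linform b,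
          rank2 p q = jac_rank H,
          forall z : 'I_m -> {fraction R},
            in_zariski_closure_image (polyLv H) z <->
            (exists lam mu : {fraction R},
               forall i, z i = vecL b i + lam * vecL p i + mu * vecL q i),
          forall z : 'I_m -> {fraction R},
            image_apex (polyLv H) z <->
            (exists lam mu : {fraction R},
               forall i, z i = vecL b i + lam * vecL p i + mu * vecL q i) &
          forall f : {mpoly {fraction R}[m]},
            (mcomp (polyLv H) f = 0 <->
             mcomp (fun i => @evar _ m 3 ord0 * (vecL p i)%:MP
                             + @evar _ m 3 (inord 1) * (vecL q i)%:MP
                             + (1 - @evar _ m 3 (inord 2)) * lift_x 3 (polyLv H i)
                             + @evar _ m 3 (inord 2) * (vecL b i)%:MP) f = 0)
            /\
            (mcomp (fun i => @evar _ m 3 ord0 * (vecL p i)%:MP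
                             + @evar _ m 3 (inord 1) * (vecL q i)%:MP
                             + (1 - @evar _ m 3 (inord 2)) * lift_x 3 (polyLv H i)
                             + @evar _ m 3 (inord 2) * (vecL b i)%:MP) f = 0 <->
             mcomp (fun i => @evar _ m 3 ord0 * (vecL p i)%:MP
                             + @evar _ m 3 (inord 1) * (vecL q i)%:MP
                             + (vecL b i)%:MP) f = 0)])).
Proof.
move=> charR _ HE; have char0 := pchar_fraction charR.
have GE := polyLv_gradE HE; rewrite (jac_rankE HE).
split; [move=> rk0 | split=> [rk1 gcdR | b apex rk2 bezR]].
- exact: (point_case (@tofrac_inj R) char0 GE rk0).
- apply: (line_case (@tofrac_inj R) char0 GE rk1) => u /rV0Pn nz_u.
  have [l [p [nz_l pE p1]]] := primitive_multiple nz_u gcdR.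
  exists l, p; split=> //; first by apply/rowP => i; rewrite [LHS]mxE [RHS]mxE; apply: pE.
  move=> k g int_g; apply: (integral_of_primitive gcdR p1 (k := k)) => a /codomP[i ->].
  exact: int_g.
- apply: (two_plane_case (@tofrac_inj R) char0 GE apex rk2) => u /rV0Pn nz_u.
  have [l [p [ps [nz_l pE pps]]]] := bezout_vector nz_u bezR.
  by exists l, p, ps; split=> //; apply/rowP => i; rewrite [LHS]mxE [RHS]mxE; apply: pE.
Qed.
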